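(* For every prime number $p$, Thompson's group $F$ has a maximal subgroup isomorphic to Jones' subgroup $\overrightarrow{F}_p$.
   Context: Thompson's group $F$ is the group of all increasing piecewise-linear homeomorphisms of $[0,1]$ with finitely many breakpoints, all in $\mathbb{Z}[\frac12]\cap(0,1)$, and all slopes integer powers of $2$. Let $\mathcal D=\mathbb{Z}[\frac12]\cap(0,1)$. For $n\ge 2$ and $i=0,\dots,n-1$ let $S_i\subseteq\mathcal D$ be the set of all dyadic fractions such that the sum of digits in their finite binary representation is $i$ modulo $n$. Jones' subgroup $\overrightarrow{F}_n$ is $\bigcap_{i=0}^{n-1}\mathrm{Stab}(S_i)$, where $\mathrm{Stab}(S)=\{f\in F: f(S)=S\}$. *)

(* Defs.v *)
From HB Require Import structures.
From mathcomp Require Import all_boot all_order all_algebra.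
From mathcomp Require Import all_classical all_reals topology normedtype.
From mathcomp Require Import ring lra.

Set Implicit Arguments.
Unset Strict Implicit.
Unset Printing Implicit Defensive.

Import Order.TTheory GRing.Theory Num.Theory.
Import numFieldNormedType.Exports.

Local Open Scope classical_set_scope.
Local Open Scope ring_scope.

Section Subgroups.
Local Open Scope group_scope.

Definition is_subgroup (G : groupType) (H : set G) : Prop :=
  group_closed [in H].

Definition maximal_subgroup (G : groupType) (H : set G) : Prop :=
  [/\ is_subgroup H, H <> setT &
      forall K : set G, is_subgroup K -> H `<=` K -> K = H \/ K = setT].

(* Only the values of [phi] on [H] matter. *)
Definition isomorphic_subgroups (G G' : groupType) (H : set G) (H' : set G')
    : Prop :=
  exists phi : G -> G',
    set_bij H H' phi /\ {in H &, {morph phi : x y / x * y}}.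

End Subgroups.

Definition homeomorphism_on (T : topologicalType) (A : set T) (f : T -> T)
    : Prop :=
  [/\ set_fun A A f, {within A, continuous f} &
      exists g : T -> T, [/\ set_fun A A g, {within A, continuous g},
                             {in A, cancel f g} & {in A, cancel g f}]].

Section Thompson.
Variable R : realType.
Implicit Types (f g : R -> R) (x y a b t c : R).

Definition dyadic x : Prop := exists (k : int) (m : nat), x = k%:~R / 2 ^+ m.

Definition dyadicI : set R := [set x | dyadic x /\ 0 < x < 1].

(* The endpoints of [a, b] may be breakpoints or lie on the boundary of
   [0, 1]; only breakpoints in the open interval ]a, b[ are excluded. *)
Definition dyadic_piecewise_linear f : Prop :=
  exists bps : seq R, (forall t, t \in bps -> dyadicI t) /\
    forall a b, 0 <= a -> a < b -> b <= 1 ->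
      (forall t, t \in bps -> ~~ (a < t < b)) ->
      exists (k : int) c, forall x, a <= x <= b -> f x = 2 ^ k * x + c.

(* A self-map of [0, 1] is represented by its extension to R by the identity,
   so that equality of elements of F is equality of functions. *)
Record is_thompson f : Prop := IsThompson {
  thompson_out : forall x, ~~ (0 <= x <= 1) -> f x = x ;
  thompson_homeo : homeomorphism_on (`[0, 1]%classic : set R) f ;
  thompson_incr : forall x y, 0 <= x -> x < y -> y <= 1 -> f x < f y ;
  thompson_pl : dyadic_piecewise_linear f }.

Lemma dyadicD x y : dyadic x -> dyadic y -> dyadic (x + y).
Proof.
move=> [k [m ->]] [l [n ->]]; exists (k * 2 ^+ n + l * 2 ^+ m), (m + n)%N.
rewrite exprD intrD !intrM !rmorphXn /=.
by field; rewrite !expf_neq0 // pnatr_eq0.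
Qed.

Lemma dyadicN x : dyadic x -> dyadic (- x).
Proof. by move=> [k [m ->]]; exists (- k), m; rewrite intrN mulNr. Qed.

Lemma dyadicB x y : dyadic x -> dyadic y -> dyadic (x - y).
Proof. by move=> dx dy; apply: dyadicD => //; apply: dyadicN. Qed.

Lemma dyadicZ (k : int) x : dyadic x -> dyadic (2 ^ k * x).
Proof.
move=> [l [m ->]]; case: k => n.
  by exists (2 ^+ n * l), m; rewrite intrM rmorphXn /= mulrA.
exists l, (m + n.+1)%N; rewrite NegzE -exprnN exprD.
by field; rewrite !expf_neq0 // pnatr_eq0.
Qed.

Lemma dyadic0 : dyadic 0.
Proof. by exists 0, 0%N; rewrite mul0r. Qed.

Lemma mem01 x : (x \in (`[0, 1]%classic : set R)) = (0 <= x <= 1).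
Proof. by rewrite mem_setE in_itv. Qed.

Lemma set01 x : (`[0, 1]%classic : set R) x <-> (0 <= x <= 1).
Proof. by rewrite /= in_itv. Qed.

Lemma homeomorphism_on_comp (T : topologicalType) (A : set T) (f g : T -> T) :
  homeomorphism_on A f -> homeomorphism_on A g -> homeomorphism_on A (f \o g).
Proof.
have comp_within (h k : T -> T) : set_fun A A k ->
    {within A, continuous h} -> {within A, continuous k} ->
    {within A, continuous h \o k}.
  move=> kA /subspace_continuousP hc /subspace_continuousP kc.
  apply/subspace_continuousP => x Ax.
  apply: (@cvg_comp _ _ _ k h _ (within A (nbhs (k x)))).
    move=> P PA; have kP := kc x Ax _ PA.
    apply: (@filterS _ (within A (nbhs x)) _
              [set y | A y /\ (A (k y) -> P (k y))]).
      by move=> y [/kA Ak]; apply.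
    exact: (@filterI _ (within A (nbhs x)) _ A _ (withinT A _) kP).
  exact: hc (kA _ Ax).
move=> [fA fc [f' [f'A f'c fK f'K]]] [gA gc [g' [g'A g'c gK g'K]]].
split; [by move=> x Ax /=; exact/fA/gA | exact: comp_within |].
exists (g' \o f'); split.
- by move=> x Ax /=; exact/g'A/f'A.
- exact: comp_within.
- by move=> x /set_mem Ax /=; rewrite fK ?inE ?gK ?inE//; exact: gA.
- by move=> x /set_mem Ax /=; rewrite g'K ?inE ?f'K ?inE//; exact: f'A.
Qed.

Section OneMap.
Variables (f : R -> R) (Ff : is_thompson f).

Lemma thompson_in x : 0 <= x <= 1 -> 0 <= f x <= 1.
Proof. by case: (thompson_homeo Ff) => fA _ _ /set01/fA/set01. Qed.

Lemma thompson_ltE x y : 0 <= x <= 1 -> 0 <= y <= 1 -> (f x < f y) = (x < y).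
Proof.
move=> /andP[x0 x1] /andP[y0 y1]; case: (ltgtP x y) => [xy|yx|->].
- exact: (thompson_incr Ff).
- by apply/negbTE; rewrite -leNgt; apply/ltW/(thompson_incr Ff).
- exact: ltxx.
Qed.

Lemma thompson_inv_ex : exists g, [/\ cancel f g, cancel g f,
  homeomorphism_on (`[0, 1]%classic : set R) g & forall x, ~~ (0 <= x <= 1) -> g x = x].
Proof.
have [fA fc [g [gA gc fK gK]]] := thompson_homeo Ff.
pose h x := if 0 <= x <= 1 then g x else x.
have hin x : 0 <= x <= 1 -> 0 <= h x <= 1.
  by rewrite /h => x01; rewrite x01; move/set01/gA/set01: x01.
have fh : cancel f h.
  move=> x; rewrite /h; case: (boolP (0 <= x <= 1)) => x01.
    by rewrite thompson_in // fK // mem01.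
  by rewrite (thompson_out Ff x01) (negbTE x01).
have hf : cancel h f.
  move=> x; rewrite /h; case: (boolP (0 <= x <= 1)) => x01.
    by rewrite gK // mem01.
  exact: thompson_out.
exists h; split => //; last by move=> x; rewrite /h => /negbTE->.
split.
- by move=> x /set01/hin/set01.
- apply: (subspace_eq_continuous _ gc).
  by move=> x; rewrite mem01 => x01; rewrite /from_subspace /h x01.
- by exists f; split => // x _.
Qed.

Definition thompson_inv : R -> R := sval (cid thompson_inv_ex).

Lemma thompson_invK : cancel f thompson_inv.
Proof. by rewrite /thompson_inv; case: cid => g []. Qed.

Lemma thompsonVK : cancel thompson_inv f.
Proof. by rewrite /thompson_inv; case: cid => g []. Qed.

Lemma thompson_inv_homeo : homeomorphism_on (`[0, 1]%classic : set R) thompson_inv.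
Proof. by rewrite /thompson_inv; case: cid => g []. Qed.

Lemma thompson_inv_out x : ~~ (0 <= x <= 1) -> thompson_inv x = x.
Proof. by rewrite /thompson_inv; case: cid => g [? ? ? +] /=; apply. Qed.

Lemma thompson_inv_in x : 0 <= x <= 1 -> 0 <= thompson_inv x <= 1.
Proof. by case: thompson_inv_homeo => fA _ _ /set01/fA/set01. Qed.

Lemma thompson_inv_ltE x y : 0 <= x <= 1 -> 0 <= y <= 1 ->
  (thompson_inv x < thompson_inv y) = (x < y).
Proof. by move=> x01 y01; rewrite -thompson_ltE ?thompson_inv_in// !thompsonVK. Qed.

Lemma thompson0 : f 0 = 0.
Proof.
have z01 : 0 <= (0 : R) <= 1 by rewrite lexx ler01.
have v01 := thompson_inv_in z01; have f01 := thompson_in z01.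
apply/eqP; rewrite eq_le; case/andP: f01 => -> _; rewrite andbT.
by rewrite -[leRHS]thompsonVK leNgt thompson_ltE// -leNgt; case/andP: v01.
Qed.

Lemma thompson1 : f 1 = 1.
Proof.
have z01 : 0 <= (1 : R) <= 1 by rewrite lexx ler01.
have v01 := thompson_inv_in z01; have f01 := thompson_in z01.
apply/eqP; rewrite eq_le; case/andP: f01 => _ ->; rewrite /=.
by rewrite -[leLHS]thompsonVK leNgt thompson_ltE// -leNgt; case/andP: v01.
Qed.

Lemma thompson_dyadic x : 0 <= x <= 1 -> dyadic (f x) <-> dyadic x.
Proof.
have [bps [dbps pl]] := thompson_pl Ff.
have H (s : seq R) : forall a b, 0 <= a -> a < b -> b <= 1 ->
    (forall t, t \in bps -> a < t < b -> t \in s) -> {subset s <= bps} ->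
    dyadic a -> dyadic (f a) -> dyadic (f b) <-> dyadic b.
  elim: s => [|t s IH] a b a0 ab b1 sP sb da dfa.
    have [t tb|k [c fE]] := pl a b a0 ab b1.
      by apply/negP => /(sP t tb).
    have E : f b - f a = 2 ^ k * (b - a).
      by rewrite !fE ?lexx ?(ltW ab)//; ring.
    have E' : b - a = 2 ^ (- k) * (f b - f a).
      by rewrite E mulrA -expfzDr ?pnatr_eq0// addNr expr0z mul1r.
    split => d.
      by rewrite -(subrK a b) E'; apply/dyadicD/da/dyadicZ/dyadicB.
    by rewrite -(subrK (f a) (f b)) E; apply/dyadicD/dfa/dyadicZ/dyadicB.
  have sb' : {subset s <= bps} by move=> u us; apply: sb; rewrite inE us orbT.
  have [/andP[at_ tb]|tN] := boolP (a < t < b); last first.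
    apply: (IH a b) => // u ub uab; have := sP u ub uab.
    by rewrite inE => /predU1P[ut|//]; move: tN; rewrite -ut uab.
  have [dt _] : dyadicI t by apply/dbps/sb; rewrite inE eqxx.
  apply: (IH t b) => //; first exact: le_trans (ltW at_).
    move=> u ub /andP[tu ub'].
    have := sP u ub; rewrite (lt_trans at_ tu) ub' => /(_ isT).
    by rewrite inE => /predU1P[ut|//]; move: tu; rewrite ut ltxx.
  apply/(IH a t) => //; first exact: le_trans (ltW tb) b1.
  move=> u ub /andP[au ut].
  have := sP u ub; rewrite (lt_trans ut tb) au => /(_ isT).
  by rewrite inE => /predU1P[tu|//]; move: ut; rewrite tu ltxx.
move=> /andP[]; rewrite le_eqVlt => /predU1P[<- _|x0 x1].
  by rewrite thompson0.
by apply: (H bps 0 x) => //; rewrite ?thompson0; exact: dyadic0.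
Qed.

Lemma thompson_dyadicI x : dyadicI x -> dyadicI (f x).
Proof.
move=> [dx /andP[x0 x1]]; have x01 : 0 <= x <= 1 by rewrite !ltW.
split; first exact/thompson_dyadic.
rewrite -[ltLHS]thompson0 -[X in _ && (_ < X)]thompson1.
by rewrite !thompson_ltE ?lexx ?ler01 ?x0.
Qed.

Lemma thompson_inv_dyadicI x : dyadicI x -> dyadicI (thompson_inv x).
Proof.
move=> [dx /andP[x0 x1]]; have x01 : 0 <= x <= 1 by rewrite !ltW.
split; first by apply/thompson_dyadic; rewrite ?thompson_inv_in// thompsonVK.
rewrite -[ltLHS](thompson_invK 0) -[X in _ && (_ < X)](thompson_invK 1).
by rewrite thompson0 thompson1 !thompson_inv_ltE ?lexx ?ler01 ?x0.
Qed.

Lemma thompson_invP : is_thompson thompson_inv.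
Proof.
split; [exact: thompson_inv_out | exact: thompson_inv_homeo | |].
  move=> x y x0 xy y1.
  have x01 : 0 <= x <= 1 by rewrite x0 (le_trans (ltW xy)).
  have y01 : 0 <= y <= 1 by rewrite y1 (le_trans x0 (ltW xy)).
  by rewrite thompson_inv_ltE.
have [bps [dbps pl]] := thompson_pl Ff.
exists (map f bps); split.
  by move=> _ /mapP[t /dbps dt ->]; exact: thompson_dyadicI.
move=> a b a0 ab b1 nb.
have a01 : 0 <= a <= 1 by rewrite a0 (le_trans (ltW ab)).
have b01 : 0 <= b <= 1 by rewrite b1 (le_trans a0 (ltW ab)).
have /andP[va0 va1] := thompson_inv_in a01.
have /andP[vb0 vb1] := thompson_inv_in b01.
have [|t tb|k [c fE]] := pl (thompson_inv a) (thompson_inv b) va0 _ vb1.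
- by rewrite thompson_inv_ltE.
- have t01 : 0 <= t <= 1 by case: (dbps t tb) => _ /andP[? ?]; rewrite !ltW.
  have := nb (f t) (map_f f tb).
  rewrite -(thompson_inv_ltE a01) ?thompson_in// thompson_invK.
  by rewrite -(thompson_inv_ltE _ b01) ?thompson_in// thompson_invK.
exists (- k), (- (2 ^ (- k) * c)) => x /andP[ax xb].
have x01 : 0 <= x <= 1 by rewrite (le_trans a0 ax) (le_trans xb).
have : f (thompson_inv x) = 2 ^ k * thompson_inv x + c.
  by apply: fE; rewrite !leNgt !thompson_inv_ltE// -!leNgt ax xb.
rewrite thompsonVK => E; rewrite [in RHS]E mulrDr mulrA -expfzDr ?pnatr_eq0//.
by rewrite addNr expr0z mul1r addrK.
Qed.

End OneMap.

Lemma thompson_id : is_thompson id.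
Proof.
split => //.
- have idc : {within `[0, 1]%classic, continuous (@id R)}.
    by apply: continuous_subspaceT => x; exact: cvg_id.
  by split => //; exists id; split.
- exists [::]; split => // a b _ _ _ _; exists 0, 0 => x _.
  by rewrite expr0z mul1r addr0.
Qed.

Lemma thompson_comp f g :
  is_thompson f -> is_thompson g -> is_thompson (f \o g).
Proof.
move=> Ff Fg; split.
- by move=> x x01 /=; rewrite (thompson_out Fg)// (thompson_out Ff).
- exact: homeomorphism_on_comp (thompson_homeo Ff) (thompson_homeo Fg).
- move=> x y x0 xy y1 /=.
  have x01 : 0 <= x <= 1 by rewrite x0 (le_trans (ltW xy)).
  have y01 : 0 <= y <= 1 by rewrite y1 (le_trans x0 (ltW xy)).
  by rewrite !(thompson_ltE Ff, thompson_ltE Fg) ?(thompson_in Fg).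
have [bf [dbf plf]] := thompson_pl Ff.
have [bg [dbg plg]] := thompson_pl Fg.
exists (bg ++ map (thompson_inv Fg) bf); split.
  move=> t; rewrite mem_cat => /orP[/dbg//|/mapP[u /dbf du ->]].
  exact: thompson_inv_dyadicI.
move=> a b a0 ab b1 nb.
have a01 : 0 <= a <= 1 by rewrite a0 (le_trans (ltW ab)).
have b01 : 0 <= b <= 1 by rewrite b1 (le_trans a0 (ltW ab)).
have [t tb|k [c gE]] := plg a b a0 ab b1.
  by apply: nb; rewrite mem_cat tb.
have /andP[ga0 _] := thompson_in Fg a01.
have /andP[_ gb1] := thompson_in Fg b01.
have [|t tb|l [d fE]] := plf (g a) (g b) ga0 _ gb1.
- by rewrite (thompson_ltE Fg).
- have t01 : 0 <= t <= 1 by case: (dbf t tb) => _ /andP[? ?]; rewrite !ltW.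
  have := nb (thompson_inv Fg t); rewrite mem_cat map_f ?orbT// => /(_ isT).
  rewrite -(thompson_ltE Fg) ?thompson_inv_in//.
  rewrite -[X in _ && X](thompson_ltE Fg) ?thompson_inv_in//.
  by rewrite !thompsonVK.
exists (l + k), (2 ^ l * c + d) => x /andP[ax xb] /=.
have x01 : 0 <= x <= 1 by rewrite (le_trans a0 ax) (le_trans xb).
rewrite fE; last by rewrite !leNgt !(thompson_ltE Fg)// -!leNgt ax.
by rewrite gE ?ax// mulrDr mulrA -expfzDr ?pnatr_eq0// addrA.
Qed.

Record thompsonF : Type := ThompsonF {
  thompson_fun :> R -> R ;
  thompson_funP : `[< is_thompson thompson_fun >] }.

HB.instance Definition _ := [isSub for thompson_fun].
HB.instance Definition _ := [Choice of thompsonF by <:].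

Lemma thompsonP (f : thompsonF) : is_thompson f.
Proof. exact/asboolP/thompson_funP. Qed.

Lemma thompsonF_eqP (f g : thompsonF) : f =1 g -> f = g.
Proof. by move=> fg; apply/val_inj/funext. Qed.

Definition F_one : thompsonF := ThompsonF (asboolT thompson_id).

Definition F_mul (f g : thompsonF) : thompsonF :=
  ThompsonF (asboolT (thompson_comp (thompsonP f) (thompsonP g))).

Definition F_inv (f : thompsonF) : thompsonF :=
  ThompsonF (asboolT (thompson_invP (thompsonP f))).

Lemma F_mulA : associative F_mul.
Proof. by move=> f g h; exact: thompsonF_eqP. Qed.

Lemma F_mul1 : left_id F_one F_mul.
Proof. by move=> f; exact: thompsonF_eqP. Qed.

Lemma F_mulr1 : right_id F_one F_mul.
Proof. by move=> f; exact: thompsonF_eqP. Qed.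

Lemma F_mulV : left_inverse F_one F_inv F_mul.
Proof. by move=> f; apply: thompsonF_eqP => x /=; exact: thompson_invK. Qed.

Lemma F_mulrV : right_inverse F_one F_inv F_mul.
Proof. by move=> f; apply: thompsonF_eqP => x /=; exact: thompsonVK. Qed.

HB.instance Definition _ :=
  isGroup.Build thompsonF F_mulA F_mul1 F_mulr1 F_mulV F_mulrV.

(* [b] lists the binary digits of [x] after the point; [x] determines it up to
   trailing zeros, which do not affect the sum of digits. *)
Definition digit_sum_class (n i : nat) : set R :=
  [set x | dyadicI x /\ exists b : seq bool,
     x = \sum_(j < size b) (nth false b j)%:R / 2 ^+ j.+1 /\
     (\sum_(j < size b) nth false b j = i %[mod n])%N].

Definition Stab (S : set R) : set thompsonF :=
  [set f : thompsonF | f @` S = S].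

Definition jones_subgroup (n : nat) : set thompsonF :=
  \bigcap_(i in `I_n) Stab (digit_sum_class n i).

Lemma Stab_subgroup (S : set R) : is_subgroup (Stab S).
Proof.
split; first by rewrite inE /Stab /= image_id.
move=> f g; rewrite !inE /Stab /= => fS gS.
rewrite -[X in _ @` X]gS image_comp -[RHS]fS; apply: eq_imagel => x _ /=.
by rewrite thompson_invK.
Qed.

Lemma jones_subgroup_subgroup (n : nat) : is_subgroup (jones_subgroup n).
Proof.
split; first by rewrite inE => i _; have [/set_mem] := Stab_subgroup (digit_sum_class n i).
move=> f g; rewrite !inE => fJ gJ i ni; apply/set_mem.
by apply: (Stab_subgroup _).2; rewrite inE; [exact: fJ | exact: gJ].
Qed.

End Thompson.

Arguments jones_subgroup : clear implicits.

(* Main.v *)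
Require Import Defs.
From mathcomp Require Import all_boot all_order all_algebra.
From mathcomp Require Import all_classical all_reals.
From mathcomp Require Import topology normedtype realfun.
From mathcomp Require Import ring lra zify.

(** Let [c x] be the digit sum of the dyadic number [x] modulo [p], the colour
    of [x]; Jones' subgroup [J] consists of the elements of [F] that preserve
    the colours ([jones_subgroupP]).  It is not maximal in [F]: the logarithm of
    the slope at 1 of an element of [J] is a multiple of [p].  But it is maximal
    in the subgroup [K] of the elements with this property, and [K] is
    isomorphic to [F] by conjugation with a homeomorphism [h] of [[0, 1]] that
    is dyadic piecewise linear away from 1 and carries the scaling by [1/2] at 1
    to the scaling by [2 ^ - p] ([rescaling_conj_near1], [rescaling_conj_onto]).
    The maximal subgroup is thus [h^-1 J h].

    For the maximality of [J] in [K], an element [f] of [F] is studied through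
    its colour shift [delta f t = c (f t) - c t].  An affine piece between
    standard dyadic intervals only replaces a prefix of the binary expansion, so
    [delta f] is a step function ([delta_steps]); it vanishes near 0, near 1 it is
    minus the logarithm of the slope at 1 ([slope_at1_color]), and
    [delta (f g) = delta f \o g + delta g].  In the other direction there is
    great freedom: any two dyadic intervals are related by a dyadic piecewise
    linear map with constant colour shift ([color_iso_all]).  In particular [J]
    can carry a finite increasing sequence of dyadics to any other one with the
    same colours.

    Now let [L] be a subgroup strictly containing [J] ([jones_overgroup]).  At the
    first jump [z] of some [delta f], with [f] in [L], the shift goes from 0 to
    some [d <> 0], and it is [d] on an interval, hence at points of every colour.
    Since [p] is prime, [d] generates [Z/p]; multiplying germs of elements of [L]
    shows that at any colour some element of [L] has an arbitrary shift on the
    left and shift 0 on the right.  Let [f] be such an element at [z], and let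
    [h], in [J], live near [z] and move some [w < z] to [z]; then [f h f^-1] shifts
    colours only on [[f w, f z[] ([shift_germ_bump]).  Composing such elements
    produces in [L] elements whose shift is any constant on any dyadic interval
    and 0 elsewhere.  These remove the jumps of the shift of a given element of
    [K] one after the other, until it lies in [J]; hence [L] contains [K]. *)

Set Implicit Arguments.
Unset Strict Implicit.
Unset Printing Implicit Defensive.

Import Order.TTheory GRing.Theory Num.Theory.
Import numFieldNormedType.Exports.

Local Open Scope classical_set_scope.
Local Open Scope ring_scope.

(** * Binary digit sums *)

Fixpoint dsum_rec (k n : nat) : nat :=
  if k is k'.+1 then (odd n + dsum_rec k' n./2)%N else 0%N.

Definition dsum (n : nat) : nat := dsum_rec n n.

Lemma dsum_recE k n : (n <= k)%N -> dsum_rec k n = dsum n.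
Proof.
have H0 m : dsum_rec m 0 = 0%N by elim: m.
have H : forall m k1 k2 n1, (n1 <= m)%N -> (n1 <= k1)%N -> (n1 <= k2)%N ->
    dsum_rec k1 n1 = dsum_rec k2 n1.
  elim=> [|m IH] [|k1] [|k2] [|n1] // n1m n1k1 n1k2; rewrite ?H0 //=.
  by congr (_ + _)%N; apply: IH; move: n1m n1k1 n1k2; clear; lia.
by move=> nk; apply: (H n).
Qed.

Lemma dsum_half n : dsum n = (odd n + dsum n./2)%N.
Proof.
case: n => [//|n]; rewrite {1}/dsum [LHS]/=; congr (_ + _)%N.
by rewrite -[(uphalf n)]/(n.+1./2) dsum_recE //; lia.
Qed.

Lemma dsum_bit (b : bool) n : dsum (b + n.*2) = (b + dsum n)%N.
Proof. by rewrite dsum_half half_bit_double oddD oddb odd_double addbF. Qed.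

Lemma dsumD i k r : (r < 2 ^ k)%N ->
  dsum (i * 2 ^ k + r) = (dsum i + dsum r)%N.
Proof.
elim: k i r => [|k IH] i r; first by case: r => // _; rewrite muln1 !addn0.
move=> rk; rewrite -{1}(odd_double_half r).
have -> : (i * 2 ^ k.+1 + (odd r + r./2.*2) =
           odd r + (i * 2 ^ k + r./2).*2)%N by rewrite expnS; lia.
rewrite dsum_bit IH; first by rewrite (dsum_half r) addnCA.
by move: rk; rewrite expnS; lia.
Qed.

Lemma dsum_mersenne k : dsum (2 ^ k).-1 = k.
Proof.
elim: k => [//|k IH].
have -> : ((2 ^ k.+1).-1 = true + (2 ^ k).-1.*2)%N.
  by have := expn_gt0 2 k; rewrite expnS; lia.
by rewrite dsum_bit IH.
Qed.

Section Dyadics.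
Variable R : realType.
Implicit Types x y t : R.

Lemma pow2_gt0 N : 0 < 2 ^+ N :> R. Proof. by rewrite exprn_gt0. Qed.

Lemma pow2_neq0 N : 2 ^+ N != 0 :> R. Proof. by rewrite gt_eqF ?pow2_gt0. Qed.

Hint Resolve pow2_gt0 pow2_neq0 : core.

Lemma pow2V_gt0 N : 0 < (2 ^+ N)^-1 :> R. Proof. by rewrite invr_gt0. Qed.

Lemma exprz2E N M : 2 ^ (N%:Z - M%:Z) = 2 ^+ N / 2 ^+ M :> R.
Proof. by rewrite expfzDr ?pnatr_eq0// -exprnN -exprnP. Qed.

Lemma dyadic_nat i N : dyadic (i%:R / 2 ^+ N : R).
Proof. by exists i%:Z, N. Qed.

Lemma dyadic1 : dyadic (1 : R).
Proof. by exists 1, 0%N; rewrite expr0 divr1. Qed.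

Lemma dyadic_raise i N k : i%:R / 2 ^+ N = (i * 2 ^ k)%:R / 2 ^+ (N + k) :> R.
Proof. by rewrite natrM natrX exprD; field; rewrite !pow2_neq0. Qed.

(** Finitely many dyadics can therefore be put over a common denominator. *)
Lemma dyadic_level x : dyadic x -> 0 <= x ->
  exists N0, forall N, (N0 <= N)%N -> exists i : nat, x = i%:R / 2 ^+ N.
Proof.
move=> [k [m ->]] x0; exists m => N mN.
have {x0}: 0 <= k%:~R :> R.
  by move: x0; rewrite pmulr_lge0 // pow2V_gt0.
rewrite ler0z; case: k => // i _.
exists (i * 2 ^ (N - m))%N.
by rewrite -pmulrn (dyadic_raise i m (N - m)) subnKC.
Qed.

Lemma ler_dyfrac i j N : (i%:R / 2 ^+ N <= j%:R / 2 ^+ N :> R) = (i <= j)%N.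
Proof. by rewrite ler_pM2r ?pow2V_gt0// ler_nat. Qed.

Lemma ltr_dyfrac i j N : (i%:R / 2 ^+ N < j%:R / 2 ^+ N :> R) = (i < j)%N.
Proof. by rewrite ltr_pM2r ?pow2V_gt0// ltr_nat. Qed.

Lemma eqr_dyfrac i j N : (i%:R / 2 ^+ N == j%:R / 2 ^+ N :> R) = (i == j)%N.
Proof. by rewrite eq_le !ler_dyfrac -eqn_leq. Qed.

Lemma dyfrac_lt1 i N : (i%:R / 2 ^+ N < 1 :> R) = (i < 2 ^ N)%N.
Proof. by rewrite ltr_pdivrMr // mul1r -natrX ltr_nat. Qed.

Lemma dyfrac_le1 i N : (i%:R / 2 ^+ N <= 1 :> R) = (i <= 2 ^ N)%N.
Proof. by rewrite ler_pdivrMr // mul1r -natrX ler_nat. Qed.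

Lemma dyfrac_mersenne N : (2 ^ N).-1%:R / 2 ^+ N = 1 - (2 ^+ N)^-1 :> R.
Proof.
have -> : (2 ^ N).-1%:R = 2 ^+ N - 1 :> R.
  by rewrite -natrX -[in RHS](prednK (expn_gt0 2 N)) -natr1 addrK.
by rewrite mulrBl divff// mul1r.
Qed.

Lemma pow2V_small (e : R) : 0 < e ->
  exists N0, forall N, (N0 <= N)%N -> (2 ^+ N)^-1 < e.
Proof.
move=> e0; exists (Num.bound e^-1) => N /upper_nthrootP H.
by rewrite -[e]invrK ltf_pV2 // posrE ?invr_gt0.
Qed.

Section Color.
Variable p : nat.

(** The digit sum modulo [p]; by uniqueness of the numerator up to trailing
    zeros the choice below is forced on nonnegative dyadics. *)
Definition color x : 'F_p :=
  xget 0 [set v | exists i N, x = i%:R / 2 ^+ N /\ v = (dsum i)%:R].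

Lemma colorE i N : color (i%:R / 2 ^+ N) = (dsum i)%:R.
Proof.
rewrite /color; case: xgetP => [v _ [j [M [E ->]]]|/(_ (dsum i)%:R)]; last first.
  by move=> H; case: H; exists i, N.
congr (_%:R); move: E.
have -> : i%:R / 2 ^+ N = (i * 2 ^ M)%:R / 2 ^+ (N + M) :> R.
  exact: dyadic_raise.
rewrite addnC [j%:R / _](dyadic_raise _ _ N) => /eqP.
rewrite eqr_dyfrac => /eqP H.
have D k l : dsum (k * 2 ^ l) = dsum k.
  by rewrite -[X in dsum X]addn0 dsumD ?expn_gt0// addn0.
by rewrite -(D i M) H D.
Qed.

(** Writing [t] as a cell's left end followed by further digits, the affine map
    between two cells only exchanges the leading digits. *)
Lemma color_cell i N j M t : dyadic t ->
  i%:R / 2 ^+ N <= t -> t < i.+1%:R / 2 ^+ N ->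
  color (2 ^+ N / 2 ^+ M * (t - i%:R / 2 ^+ N) + j%:R / 2 ^+ M) =
  color t + ((dsum j)%:R - (dsum i)%:R).
Proof.
move=> dt it ti.
have t0 : 0 <= t by apply: le_trans it; rewrite divr_ge0// ltW.
have [K0 /(_ (N + K0)%N (leq_addl _ _)) [n tE]] := dyadic_level dt t0.
move: it ti; rewrite tE (dyadic_raise i _ K0) (dyadic_raise i.+1 _ K0).
rewrite ler_dyfrac ltr_dyfrac mulSn => i1 i2.
have nE : (n = i * 2 ^ K0 + (n - i * 2 ^ K0))%N by rewrite subnKC.
set r := (n - _)%N in nE.
have rK : (r < 2 ^ K0)%N by move: i2; rewrite nE; lia.
have -> : 2 ^+ N / 2 ^+ M *
      (n%:R / 2 ^+ (N + K0) - (i * 2 ^ K0)%:R / 2 ^+ (N + K0)) + j%:R / 2 ^+ M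
    = (j * 2 ^ K0 + r)%:R / 2 ^+ (M + K0) :> R.
  rewrite nE !natrD !natrM !natrX !exprD.
  by field; rewrite !pow2_neq0.
by rewrite !colorE nE !dsumD// !natrD; ring.
Qed.

(** Every colour occurs in every interval: append enough digits 1. *)
Lemma color_dense (p_pr : prime p) x y (c : 'F_p) : 0 <= x -> x < y ->
  exists t, [/\ dyadic t, x < t, t < y & color t = c].
Proof.
move=> x0 xy.
have [N /(_ N (leqnn _)) HN] : exists N0, forall N, (N0 <= N)%N -> (2 ^+ N)^-1 < (y - x) / 2.
  by apply: pow2V_small; rewrite divr_gt0 // subr_gt0.
pose i := (Num.truncn (x * 2 ^+ N)).+1.
have /andP[xi1 xi2] := truncn_itv (mulr_ge0 x0 (ltW (pow2_gt0 N))).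
have ix : x < i%:R / 2 ^+ N by rewrite ltr_pdivlMr.
have iy : i.+1%:R / 2 ^+ N < y.
  rewrite -natr1 mulrDl /i -natr1 mulrDl mul1r.
  have : (Num.truncn (x * 2 ^+ N))%:R / 2 ^+ N <= x by rewrite ler_pdivrMr.
  by move: HN; lra.
have [k kE] : exists k, k%:R = c - (dsum i)%:R :> 'F_p.
  by exists (val (c - (dsum i)%:R)); rewrite natr_Zp.
have pk := expn_gt0 2 k.
exists ((i * 2 ^ k + (2 ^ k).-1)%:R / 2 ^+ (N + k)); split.
- exact: dyadic_nat.
- apply: lt_le_trans ix _; rewrite (dyadic_raise i _ k) ler_dyfrac; lia.
- apply: lt_trans iy; rewrite (dyadic_raise i.+1 _ k) ltr_dyfrac; lia.
- by rewrite colorE dsumD ?prednK// dsum_mersenne natrD kE addrC subrK.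
Qed.

End Color.
End Dyadics.

#[global] Hint Resolve pow2_gt0 pow2_neq0 : core.

(** * Dyadic piecewise linear maps between intervals *)

Section PL.
Variable R : realType.
Implicit Types (f g : R -> R) (a b c m t x y : R).

(** With explicit ends and cutting points, gluing, composing and inverting are
    inductions.  For self-maps of [[0, 1]] the notion is that of [is_thompson]: see
    [pl_thompson] and [thompson_plP]. *)
Inductive pl f : R -> R -> Prop :=
| pl_affine a b (k : int) c of dyadic a & dyadic b & a < b & dyadic c
    & (forall x, a <= x <= b -> f x = 2 ^ k * x + c) : pl f a b
| pl_cat a m b of pl f a m & pl f m b : pl f a b.

Lemma exp2z_gt0 (k : int) : 0 < 2 ^ k :> R.
Proof. by rewrite exprz_gt0. Qed.

Lemma exp2z_neq0 (k : int) : 2 ^ k != 0 :> R.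
Proof. by rewrite gt_eqF ?exp2z_gt0. Qed.

Lemma exp2zN (k : int) : 2 ^ (- k) = (2 ^ k)^-1 :> R.
Proof. by rewrite invr_expz. Qed.

Lemma pl_lt f a b : pl f a b -> a < b.
Proof. by elim=> // {}a m {}b _ am _ mb; exact: lt_trans mb. Qed.

Lemma pl_dyadicl f a b : pl f a b -> dyadic a.
Proof. by elim. Qed.

Lemma pl_dyadicr f a b : pl f a b -> dyadic b.
Proof. by elim. Qed.

Lemma pl_dyadic f a b : pl f a b ->
  forall x, a <= x <= b -> dyadic x -> dyadic (f x).
Proof.
elim=> {a b} [a b k c da db ab dc fE x xab dx|a m b _ IH1 _ IH2 x /andP[ax xb] dx].
  by rewrite fE //; apply: dyadicD => //; exact: dyadicZ.
by case: (leP x m) => xm; [apply: IH1|apply: IH2] => //; rewrite ?ax ?xm// xb ltW.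
Qed.

Lemma pl_ext f g a b : (forall x, a <= x <= b -> f x = g x) -> pl f a b -> pl g a b.
Proof.
move=> + H; elim: H => {a b} [a b k c da db ab dc fE|a m b P1 IH1 P2 IH2] fg.
  by apply: (@pl_affine _ _ _ k c) => // x xab; rewrite -fg// fE.
have am := pl_lt P1; have mb := pl_lt P2.
apply: (@pl_cat _ _ m).
  by apply: IH1 => x /andP[ax xm]; apply: fg; rewrite ax (le_trans xm)// ltW.
by apply: IH2 => x /andP[mx xb]; apply: fg; rewrite xb (le_trans (ltW am)).
Qed.

Lemma pl_incr f a b : pl f a b ->
  forall x y, a <= x -> x < y -> y <= b -> f x < f y.
Proof.
elim=> {a b} [a b k c da db ab dc fE|a m b P1 IH1 P2 IH2] x y ax xy yb.
  rewrite !fE ?ax ?yb ?(le_trans (ltW xy))// ?(le_trans ax (ltW xy))//.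
  by rewrite ltrD2r ltr_pM2l ?exp2z_gt0.
have am := pl_lt P1; have mb := pl_lt P2.
case: (leP y m) => [ym|my]; first exact: IH1.
case: (leP m x) => [mx|xm]; first exact: IH2.
by apply: (lt_trans (y := f m)); [apply: IH1|apply: IH2].
Qed.

Lemma pl_le f a b : pl f a b ->
  forall x y, a <= x -> x <= y -> y <= b -> f x <= f y.
Proof.
move=> P x y ax; rewrite le_eqVlt => /predU1P[->//|xy] yb.
by apply/ltW/(pl_incr P).
Qed.

Lemma pl_onto f a b : pl f a b ->
  forall y, f a <= y <= f b -> exists2 x, a <= x <= b & f x = y.
Proof.
elim=> {a b} [a b k c da db ab dc fE|a m b P1 IH1 P2 IH2] y.
  rewrite !fE ?lexx ?(ltW ab)// => /andP[ay yb].
  have xab : a <= (y - c) / 2 ^ k <= b.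
    by rewrite ler_pdivlMr ?ler_pdivrMr ?exp2z_gt0// lerBrDr lerBlDr !(mulrC _ (2 ^ k)) ay.
  by exists ((y - c) / 2 ^ k) => //; rewrite fE// mulrC divfK ?exp2z_neq0// subrK.
have am := pl_lt P1; have mb := pl_lt P2.
move=> /andP[ay yb]; case: (leP y (f m)) => ym.
  have [|x /andP[ax xm] <-] := IH1 y; first by rewrite ay.
  by exists x => //; rewrite ax (le_trans xm)// ltW.
have [|x /andP[ax xm] <-] := IH2 y; first by rewrite yb ltW.
by exists x => //; rewrite xm (le_trans _ ax)// ltW.
Qed.

Lemma pl_inv f g a b : pl f a b -> (forall x, a <= x <= b -> g (f x) = x) ->
  pl g (f a) (f b).
Proof.
elim=> {a b} [a b k c da db ab dc fE|a m b P1 IH1 P2 IH2] gf.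
  have P : pl f a b by apply: (@pl_affine _ _ _ k c).
  have aa : a <= a <= b by rewrite lexx ltW.
  have bb : a <= b <= b by rewrite lexx ltW.
  apply: (@pl_affine _ _ _ (- k) (- (2 ^ (- k) * c))).
  - exact: (pl_dyadic P aa).
  - exact: (pl_dyadic P bb).
  - exact: (pl_incr P).
  - by apply: dyadicN; exact: dyadicZ.
  move=> _ /(pl_onto P)[x xab <-]; rewrite gf// fE// exp2zN.
  by field; rewrite exp2z_neq0.
have am := pl_lt P1; have mb := pl_lt P2.
apply: (@pl_cat _ _ (f m)).
  by apply: IH1 => x /andP[ax xm]; apply: gf; rewrite ax (le_trans xm)// ltW.
by apply: IH2 => x /andP[mx xb]; apply: gf; rewrite xb (le_trans (ltW am)).
Qed.

Lemma pl_sub f a b : pl f a b -> forall a' b', dyadic a' -> dyadic b' ->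
  a <= a' -> a' < b' -> b' <= b -> pl f a' b'.
Proof.
elim=> {a b} [a b k c da db ab dc fE|a m b P1 IH1 P2 IH2] a' b' da' db' aa ab' bb.
  apply: (@pl_affine _ _ _ k c) => // x /andP[ax xb].
  by apply: fE; rewrite (le_trans aa)//= (le_trans xb).
case: (leP b' m) => [bm|mb']; first exact: IH1.
case: (leP m a') => [ma|am']; first exact: IH2.
have dm := pl_dyadicr P1.
by apply: (@pl_cat _ _ m); [apply: IH1|apply: IH2].
Qed.

(** The cutting points of the outer map are pulled back by the affine one. *)
Lemma pl_comp_affine f g c d : pl g c d ->
  forall a b (k : int) e, dyadic a -> dyadic b -> a < b -> dyadic e ->
    c = 2 ^ k * a + e -> d = 2 ^ k * b + e ->
    (forall x, a <= x <= b -> f x = 2 ^ k * x + e) -> pl (g \o f) a b.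
Proof.
elim=> {c d} [c d l h _ _ _ dh gE|c m d P1 IH1 P2 IH2] a b k e da db ab de cE dE fE.
  apply: (@pl_affine _ _ _ (l + k) (2 ^ l * e + h)) => //.
    by apply: dyadicD => //; exact: dyadicZ.
  move=> x xab /=; rewrite fE// gE; last first.
    by rewrite cE dE !lerD2r !ler_pM2l ?exp2z_gt0.
  by rewrite expfzDr ?pnatr_eq0//; ring.
have cm := pl_lt P1; have md := pl_lt P2.
pose m' := (m - e) / 2 ^ k.
have mE : m = 2 ^ k * m' + e by rewrite /m'; field; exact: exp2z_neq0.
have dm' : dyadic m'.
  rewrite /m' mulrC -exp2zN; apply: dyadicZ; apply: dyadicB => //.
  exact: pl_dyadicr P1.
move: cm md; rewrite cE mE dE !ltrD2r !ltr_pM2l ?exp2z_gt0// => am mb.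
apply: (@pl_cat _ _ m').
  apply: (IH1 a m' k e) => // x /andP[ax xm].
  by apply: fE; rewrite ax (le_trans xm)// ltW.
apply: (IH2 m' b k e) => // x /andP[ax xm].
by apply: fE; rewrite xm (le_trans (ltW am)).
Qed.

Lemma pl_comp f g a b : pl f a b -> pl g (f a) (f b) -> pl (g \o f) a b.
Proof.
elim=> {a b} [a b k c da db ab dc fE|a m b P1 IH1 P2 IH2] Pg.
  by apply: (pl_comp_affine Pg (k := k) (e := c)) => //; apply: fE; rewrite lexx ltW.
have am := pl_lt P1; have mb := pl_lt P2.
have fam : f a < f m by apply: (pl_incr P1).
have fmb : f m < f b by apply: (pl_incr P2).
have dfa := pl_dyadicl Pg; have dfb := pl_dyadicr Pg.
have dfm : dyadic (f m).
  by apply: (pl_dyadic P1); rewrite ?lexx ?(ltW am)//; exact: pl_dyadicr P1.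
by apply: (@pl_cat _ _ m); [apply: IH1|apply: IH2];
  apply: (pl_sub Pg) => //; apply/ltW.
Qed.

Lemma pl_id a b : dyadic a -> dyadic b -> a < b -> pl id a b.
Proof.
move=> da db ab; apply: (@pl_affine _ _ _ 0 0) => //; first exact: dyadic0.
by move=> x _; rewrite expr0z mul1r addr0.
Qed.

Definition glue m f g t := if t < m then f t else g t.

Lemma glueL m f g t : t < m -> glue m f g t = f t.
Proof. by rewrite /glue => ->. Qed.

Lemma glueR m f g t : m <= t -> glue m f g t = g t.
Proof. by rewrite /glue leNgt => /negbTE ->. Qed.

Lemma pl_glue f g a m b : pl f a m -> pl g m b -> f m = g m ->
  pl (glue m f g) a b.
Proof.
move=> P1 P2 E; apply: (@pl_cat _ _ m).
  apply: pl_ext P1 => x /andP[_]; rewrite le_eqVlt => /predU1P[->|xm].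
    by rewrite glueR.
  by rewrite glueL.
by apply: pl_ext P2 => x /andP[mx _]; rewrite glueR.
Qed.

Lemma pl_last f a b : pl f a b -> exists m (k : int) c,
  [/\ a <= m, m < b & forall x, m <= x <= b -> f x = 2 ^ k * x + c].
Proof.
elim=> {a b} [a b k c da db ab dc fE|a m b P1 IH1 P2 [m' [k [c [mm mb fE]]]]].
  by exists a, k, c.
by exists m', k, c; split => //; apply: le_trans mm; apply/ltW/(pl_lt P1).
Qed.

Lemma pl_breakpoints f a b : pl f a b ->
  exists bps : seq R, (forall t, t \in bps -> dyadic t /\ a < t < b) /\
    forall u v, a <= u -> u < v -> v <= b ->
      (forall t, t \in bps -> ~~ (u < t < v)) ->
      exists (k : int) c, forall x, u <= x <= v -> f x = 2 ^ k * x + c.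
Proof.
elim=> {a b} [a b k c da db ab dc fE|a m b P1 [s1 [s1d s1P]] P2 [s2 [s2d s2P]]].
  exists [::]; split=> // u v au uv vb _; exists k, c => x /andP[ux xv].
  by apply: fE; rewrite (le_trans au)//= (le_trans xv).
have am := pl_lt P1; have mb := pl_lt P2.
exists (m :: s1 ++ s2); split=> [t|u v au uv vb H].
  rewrite inE mem_cat => /or3P[/eqP->|/s1d[dt /andP[at_ tm]]|/s2d[dt /andP[mt tb]]].
  - by rewrite am mb; split=> //; exact: pl_dyadicr P1.
  - by rewrite at_ (lt_trans tm).
  - by rewrite tb (lt_trans am).
have := H m; rewrite inE eqxx negb_and -!leNgt => /(_ isT)/orP[mu|vm].
  by apply: s2P => // t ts; apply: H; rewrite inE mem_cat ts !orbT.
by apply: s1P => // t ts; apply: H; rewrite inE mem_cat ts orbT.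
Qed.

(** Continuity is automatic, here and for the inverse, since increasing
    surjections between segments are continuous. *)
Lemma pl_thompson f : pl f 0 1 -> f 0 = 0 -> f 1 = 1 ->
  (forall x, ~~ (0 <= x <= 1) -> f x = x) -> is_thompson f.
Proof.
move=> P f0 f1 fout.
have fin x : 0 <= x <= 1 -> 0 <= f x <= 1.
  by move=> /andP[x0 x1]; rewrite -{1}f0 -f1 !(pl_le P) ?lexx.
have [g gP] : {g : R -> R & forall y, 0 <= y <= 1 -> 0 <= g y <= 1 /\ f (g y) = y}.
  apply: (@choice _ _ (fun y x => 0 <= y <= 1 -> 0 <= x <= 1 /\ f x = y)) => y.
  have [y01|] := boolP (0 <= y <= 1); last by exists 0.
  by have [|x x01 fx] := pl_onto P (y := y); [rewrite f0 f1|exists x].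
have cont h : (forall x, 0 <= x <= 1 -> 0 <= h x <= 1) ->
    (forall x y, 0 <= x -> x < y -> y <= 1 -> h x < h y) ->
    (forall y, 0 <= y <= 1 -> exists2 x, 0 <= x <= 1 & h x = y) ->
    {within `[0, 1]%classic, continuous h}.
  move=> hin hlt hon.
  have h0 : h 0 = 0.
    have [|x /andP[x0 x1] hx] := hon 0; first by rewrite lexx ler01.
    have /andP[H _] := hin 0 ltac:(by rewrite lexx ler01).
    apply/eqP; rewrite eq_le H andbT -[leRHS]hx.
    case: (ltP 0 x) => [xp|xn]; first by apply/ltW/hlt.
    by have -> : x = 0 by apply/eqP; rewrite eq_le xn x0.
  have h1 : h 1 = 1.
    have [|x /andP[x0 x1] hx] := hon 1; first by rewrite lexx ler01.
    have /andP[_ H] := hin 1 ltac:(by rewrite lexx ler01).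
    apply/eqP; rewrite eq_le H /= -[leLHS]hx.
    case: (ltP x 1) => [xp|xn]; first by apply/ltW/hlt.
    by have -> : x = 1 by apply/eqP; rewrite eq_le xn x1.
  apply: segment_inc_surj_continuous.
    move=> x y; rewrite !in_itv /= => /andP[x0 x1] /andP[y0 y1].
    apply: (le_mono_in (D := [pred z | 0 <= z <= 1])) => /=; rewrite ?inE ?x0 ?y0//.
    by move=> u v /andP[u0 u1] /andP[v0 v1] uv; apply: hlt.
  move=> y /=; rewrite in_itv /= h0 h1 => /hon[x x01 <-].
  by exists x => //=; rewrite in_itv.
have glt x y : 0 <= x -> x < y -> y <= 1 -> g x < g y.
  move=> x0 xy y1.
  have [/andP[gx0 gx1] fgx] := gP x ltac:(by rewrite x0 (le_trans (ltW xy))).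
  have [/andP[gy0 gy1] fgy] := gP y ltac:(by rewrite y1 (le_trans x0 (ltW xy))).
  rewrite ltNge; apply/negP => H; have := pl_le P gy0 H gx1.
  by rewrite fgx fgy leNgt xy.
have gf x : 0 <= x <= 1 -> g (f x) = x.
  move=> x01; have [/andP[g0 g1] E] := gP _ (fin _ x01).
  case/andP: x01 => x0 x1.
  case: (ltgtP (g (f x)) x) => // H.
    by have := pl_incr P g0 H x1; rewrite E ltxx.
  by have := pl_incr P x0 H g1; rewrite E ltxx.
split=> //.
- split.
  + by move=> x /set01/fin/set01.
  + apply: cont => //; first exact: pl_incr P.
    by move=> y y01; have [? ?] := gP y y01; exists (g y).
  exists g; split.
  + by move=> x /set01/gP[? _]; apply/set01.
  + apply: cont => //; first by move=> x /gP[].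
    by move=> y y01; exists (f y); [exact: fin|exact: gf].
  + by move=> x; rewrite mem01; exact: gf.
  + by move=> x; rewrite mem01 => /gP[].
- exact: pl_incr P.
- have [s [sd sP]] := pl_breakpoints P.
  by exists s; split=> // t /sd.
Qed.

Lemma thompson_plP f : is_thompson f -> pl f 0 1.
Proof.
move=> Ff; have [bps [dbps plf]] := thompson_pl Ff.
have H (s : seq R) : forall a b, 0 <= a -> a < b -> b <= 1 -> dyadic a -> dyadic b ->
    (forall t, t \in bps -> a < t < b -> t \in s) -> {subset s <= bps} -> pl f a b.
  elim: s => [|t s IH] a b a0 ab b1 da db sP sb.
    have [t tb|k [c fE]] := plf a b a0 ab b1.
      by apply/negP => /(sP t tb).
    apply: (@pl_affine _ _ _ k c) => //.
    have -> : c = f a - 2 ^ k * a by rewrite fE ?lexx ?(ltW ab)//; ring.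
    apply: dyadicB; last exact: dyadicZ.
    by apply/(thompson_dyadic Ff) => //; rewrite a0 (le_trans (ltW ab)).
  have sb' : {subset s <= bps} by move=> u us; apply: sb; rewrite inE us orbT.
  have [/andP[at_ tb]|tN] := boolP (a < t < b); last first.
    apply: (IH a b) => // u ub uab; have := sP u ub uab.
    by rewrite inE => /predU1P[ut|//]; move: tN; rewrite -ut uab.
  have [dt _] : dyadicI t by apply/dbps/sb; rewrite inE eqxx.
  apply: (@pl_cat _ _ t).
    apply: (IH a t) => //; first exact: le_trans (ltW tb) b1.
    move=> u ub /andP[au ut].
    have := sP u ub; rewrite (lt_trans ut tb) au => /(_ isT).
    by rewrite inE => /predU1P[tu|//]; move: ut; rewrite tu ltxx.
  apply: (IH t b) => //; first exact: le_trans (ltW at_).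
  move=> u ub /andP[tu ub'].
  have := sP u ub; rewrite (lt_trans at_ tu) ub' => /(_ isT).
  by rewrite inE => /predU1P[ut|//]; move: tu; rewrite ut ltxx.
by apply: (H bps) => //; [exact: dyadic0|exact: dyadic1].
Qed.

End PL.

(** * Maps shifting colours by a constant *)

Section Shift.
Variables (R : realType) (p : nat).
Hypothesis p_prime : prime p.
Implicit Types (f g : R -> R) (a b c m t x y z : R).

Local Notation col := (@color R p).

Lemma pl_inverse f a b : pl f a b -> exists g,
  pl g (f a) (f b) /\ forall x, a <= x <= b -> g (f x) = x.
Proof.
move=> P; exists (fun y => xget 0 [set x | a <= x <= b /\ f x = y]).
have H x : a <= x <= b -> xget 0 [set x' | a <= x' <= b /\ f x' = f x] = x.
  move=> /andP[ax xb]; case: xgetP => [z _ [/andP[az zb] E]|/(_ x)]; last first.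
    by case; split=> //; rewrite ax.
  case: (ltgtP z x) => // H.
    by have := pl_incr P az H xb; rewrite E ltxx.
  by have := pl_incr P ax H zb; rewrite E ltxx.
by split=> //; exact: (pl_inv P).
Qed.

(** The shift, being constant, is the one of the left end; the right end is left
    out, so that the colours of [x'] and [y'] are unrelated. *)
Definition color_iso x x' y y' := exists f, [/\ pl f x x', f x = y, f x' = y' &
  forall t, dyadic t -> x <= t -> t < x' ->
    col (f t) = col t + (col y - col x)].

Lemma color_iso_refl x x' : dyadic x -> dyadic x' -> x < x' -> color_iso x x' x x'.
Proof.
move=> dx dx' xx'; exists id; split=> //; first exact: pl_id.
by move=> t _ _ _; rewrite subrr addr0.
Qed.

Lemma color_iso_sym x x' y y' : color_iso x x' y y' -> color_iso y y' x x'.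
Proof.
move=> [f [P <- <- fc]]; have xx' := pl_lt P.
have [g [Pg gK]] := pl_inverse P; exists g; split=> //.
- by rewrite gK // lexx ltW.
- by rewrite gK // lexx ltW.
move=> t dt xt tx'.
have [|u /andP[xu ux'] E] := pl_onto P (y := t); first by rewrite xt ltW.
rewrite -E gK ?xu//.
have du : dyadic u.
  by have := pl_dyadic Pg _ dt; rewrite xt (ltW tx') -E gK ?xu//; exact.
have ux : u < x' by rewrite ltNge; apply/negP => /(pl_le P _)-/(_ ltac:(exact: ltW) ux'); rewrite E leNgt tx'.
by rewrite fc //; ring.
Qed.

Lemma color_iso_trans x x' y y' z z' : color_iso x x' y y' -> color_iso y y' z z' -> color_iso x x' z z'.
Proof.
move=> [f [P fx fx' fc]] [g [Pg gy gy' gc]]; have xx' := pl_lt P.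
exists (g \o f); split=> /=; rewrite ?fx ?fx' //.
  by apply: pl_comp => //; rewrite fx fx'.
move=> t dt xt tx'; rewrite gc ?fc//; first by ring.
- by apply: (pl_dyadic P) => //; rewrite xt ltW.
- by rewrite -fx (pl_le P)// ltW.
- by rewrite -fx' (pl_incr P).
Qed.

Lemma color_iso_cat x m x' y n y' : color_iso x m y n -> color_iso m x' n y' ->
  col n - col m = col y - col x -> color_iso x x' y y'.
Proof.
move=> [f [P fx fm fc]] [g [Pg gm gx' gc]] E.
have xm := pl_lt P; have mx' := pl_lt Pg.
exists (glue m f g); split.
- by apply: pl_glue => //; rewrite fm.
- by rewrite glueL.
- by rewrite glueR // ltW.
move=> t dt xt tx'; case: (ltP t m) => tm.
  by rewrite glueL// fc.
by rewrite glueR// gc// E.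
Qed.

Lemma color_iso_cell i N j M : color_iso (i%:R / 2 ^+ N) (i.+1%:R / 2 ^+ N)
  (j%:R / 2 ^+ M) (j.+1%:R / 2 ^+ M).
Proof.
exists (fun t => 2 ^+ N / 2 ^+ M * (t - i%:R / 2 ^+ N) + j%:R / 2 ^+ M); split.
- apply: (@pl_affine _ _ _ _ (N%:Z - M%:Z)
    (j%:R / 2 ^+ M - 2 ^ (N%:Z - M%:Z) * (i%:R / 2 ^+ N))).
  + exact: dyadic_nat.
  + exact: dyadic_nat.
  + by rewrite ltr_dyfrac.
  + by apply: dyadicB; [|apply: dyadicZ]; exact: dyadic_nat.
  + by move=> x _; rewrite exprz2E; ring.
- by rewrite subrr mulr0 add0r.
- by rewrite -[i.+1%:R]natr1 -[j.+1%:R]natr1; field; rewrite !pow2_neq0.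
- by move=> t dt it ti; rewrite color_cell // !colorE.
Qed.

(** Let [n >= 2] be the difference modulo [p] of the colours of two consecutive
    cells.  In the first one, fix everything to the left of the last piece of
    relative length [2 ^ - (n - 1)], and contract that piece to its left half.
    The right half, thus freed, is a cell whose address is followed by [n]
    digits 1: it has the colour of the second cell, which is sent to it. *)
Lemma color_iso_absorb i N : color_iso (i%:R / 2 ^+ N) (i.+2%:R / 2 ^+ N)
  (i%:R / 2 ^+ N) (i.+1%:R / 2 ^+ N).
Proof.
(* The difference is written [k.+2], so that the fixed part is not empty. *)
have [k kE] : exists k, k.+1%:R = (dsum i.+1)%:R - (dsum i)%:R - 1 :> 'F_p.
  exists (val ((dsum i.+1)%:R - (dsum i)%:R - 1 - 1 : 'F_p)).
  by rewrite -natr1 natr_Zp subrK.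
pose u : R := (i * 2 ^ k.+1 + (2 ^ k.+1).-1)%:R / 2 ^+ (N + k.+1).
pose v : R := (i * 2 ^ k.+2 + (2 ^ k.+2).-1)%:R / 2 ^+ (N + k.+2).
have pk : (0 < 2 ^ k)%N by rewrite expn_gt0.
have iu : i%:R / 2 ^+ N < u.
  by rewrite /u (dyadic_raise _ i _ k.+1) ltr_dyfrac expnS; lia.
have uE : (i * 2 ^ k.+1 + (2 ^ k.+1).-1).+1%:R / 2 ^+ (N + k.+1) = i.+1%:R / 2 ^+ N :> R.
  by rewrite (dyadic_raise _ i.+1 _ k.+1); congr (_%:R / _); rewrite expnS; lia.
have vE : (i * 2 ^ k.+2 + (2 ^ k.+2).-1).+1%:R / 2 ^+ (N + k.+2) = i.+1%:R / 2 ^+ N :> R.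
  by rewrite (dyadic_raise _ i.+1 _ k.+2); congr (_%:R / _); rewrite !expnS; lia.
have uE' : (i * 2 ^ k.+2 + (2 ^ k.+1).-1.*2)%:R / 2 ^+ (N + k.+2) = u.
  rewrite /u [RHS](dyadic_raise _ _ _ 1) -addnA addn1 expn1; congr (_%:R / _).
  by rewrite !expnS; lia.
have vE' : (i * 2 ^ k.+2 + (2 ^ k.+1).-1.*2).+1%:R / 2 ^+ (N + k.+2) = v.
  by rewrite /v; congr (_%:R / _); rewrite !expnS; lia.
have du : dyadic u by exact: dyadic_nat.
apply: (@color_iso_cat _ u _ _ u); [exact/color_iso_refl/iu/du/dyadic_nat| |by rewrite !subrr].
apply: (@color_iso_cat _ (i.+1%:R / 2 ^+ N) _ _ v).
- by have := color_iso_cell (i * 2 ^ k.+1 + (2 ^ k.+1).-1) (N + k.+1)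
    (i * 2 ^ k.+2 + (2 ^ k.+1).-1.*2) (N + k.+2); rewrite uE uE' vE'.
- by have := color_iso_cell i.+1 N (i * 2 ^ k.+2 + (2 ^ k.+2).-1) (N + k.+2); rewrite vE.
rewrite subrr /v !colorE dsumD ?prednK ?expn_gt0// dsum_mersenne natrD.
by rewrite -[k.+2%:R]natr1 kE; ring.
Qed.

(** The cells are absorbed one by one, starting from the right. *)
Lemma color_iso_first_cell i j N : (i < j)%N ->
  color_iso (i%:R / 2 ^+ N) (j%:R / 2 ^+ N) (i%:R / 2 ^+ N) (i.+1%:R / 2 ^+ N).
Proof.
move=> ij; have [d ->] : exists d, j = (i.+1 + d)%N by exists (j - i.+1)%N; lia.
elim: d => [|d IH].
  by rewrite addn0; apply: color_iso_refl; rewrite ?ltr_dyfrac //; exact: dyadic_nat.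
apply: color_iso_trans IH; case: d => [|d].
  by rewrite addn1 addn0; exact: color_iso_absorb.
rewrite !addnS.
apply: (@color_iso_cat _ ((i + d.+1)%:R / 2 ^+ N) _ _ ((i + d.+1)%:R / 2 ^+ N)).
- by apply: color_iso_refl; rewrite ?ltr_dyfrac //; [exact: dyadic_nat|exact: dyadic_nat|lia].
- by rewrite addSn addnS; exact: color_iso_absorb.
- by rewrite !subrr.
Qed.

(** Over a common denominator, both intervals reduce to their first cells. *)
Lemma color_iso_all x x' y y' : dyadic x -> dyadic x' -> dyadic y -> dyadic y' ->
  0 <= x -> x < x' -> 0 <= y -> y < y' -> color_iso x x' y y'.
Proof.
move=> dx dx' dy dy' x0 xx' y0 yy'.
have [N1 H1] := dyadic_level dx x0.
have [N2 H2] := dyadic_level dx' (le_trans x0 (ltW xx')).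
have [N3 H3] := dyadic_level dy y0.
have [N4 H4] := dyadic_level dy' (le_trans y0 (ltW yy')).
pose N := maxn (maxn N1 N2) (maxn N3 N4).
have [i1 E1] := H1 N ltac:(rewrite /N; lia).
have [i2 E2] := H2 N ltac:(rewrite /N; lia).
have [i3 E3] := H3 N ltac:(rewrite /N; lia).
have [i4 E4] := H4 N ltac:(rewrite /N; lia).
move: xx' yy'; rewrite E1 E2 E3 E4 !ltr_dyfrac => i12 i34.
apply: color_iso_trans (color_iso_first_cell N i12) _.
apply: color_iso_trans (color_iso_cell i1 N i3 N) _.
exact/color_iso_sym/color_iso_first_cell.
Qed.

(** * Elements of Thompson's group with prescribed colour shifts *)

Lemma dyadicI_ge0 x : dyadicI x -> 0 <= x.
Proof. by move=> [_ /andP[/ltW]]. Qed.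

Lemma dyadicI_lt1 x : dyadicI x -> x < 1.
Proof. by move=> [_ /andP[]]. Qed.

Lemma dyadicI_01 x : dyadicI x -> 0 <= x <= 1.
Proof. by move=> [_ /andP[x0 x1]]; rewrite !ltW. Qed.

Lemma thompson_of_pl f : pl f 0 1 -> f 0 = 0 -> f 1 = 1 ->
  exists g : thompsonF R, forall t, 0 <= t <= 1 -> g t = f t.
Proof.
move=> P f0 f1; pose h t := if 0 <= t <= 1 then f t else t.
have hf t : 0 <= t <= 1 -> h t = f t by rewrite /h => ->.
suff Fh : is_thompson h by exists (ThompsonF (asboolT Fh)).
apply: pl_thompson.
- by apply: pl_ext P => t t01; rewrite hf.
- by rewrite hf ?lexx ?ler01.
- by rewrite hf ?lexx ?ler01.
- by move=> t; rewrite /h => /negbTE ->.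
Qed.

(** One piece for each of three intervals; the condition on [x'] and [y'] makes
    the shift vanish on the last one. *)
Lemma exists_shift x x' y y' : dyadicI x -> dyadicI x' -> dyadicI y -> dyadicI y' ->
  x < x' -> y < y' -> col x' = col y' -> exists g : thompsonF R,
  [/\ g x = y, g x' = y',
     forall t, dyadicI t -> x <= t < x' -> col (g t) = col t + (col y - col x) &
     forall t, dyadicI t -> ~~ (x <= t < x') -> col (g t) = col t].
Proof.
move=> Dx Dx' Dy Dy' xx' yy' cE.
have [dx /andP[x0 x1]] := Dx; have [dx' /andP[x'0 x'1]] := Dx'.
have [dy /andP[y0 y1]] := Dy; have [dy' /andP[y'0 y'1]] := Dy'.
have d0 := dyadic0 R; have d1 := dyadic1 R.
have [f1 [P1 f10 f1x c1]] := color_iso_all d0 dx d0 dy (lexx 0) x0 (lexx 0) y0.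
have [f2 [P2 f2x f2x' c2]] := color_iso_all dx dx' dy dy' (ltW x0) xx' (ltW y0) yy'.
have [f3 [P3 f3x' f31 c3]] := color_iso_all dx' d1 dy' d1 (ltW x'0) x'1 (ltW y'0) y'1.
have [|||g gE] := @thompson_of_pl (glue x f1 (glue x' f2 f3)).
- apply: pl_glue => //; first by apply: pl_glue => //; rewrite f2x'.
  by rewrite glueL // f2x.
- by rewrite glueL.
- by rewrite !glueR // ltW.
exists g; split.
- by rewrite gE ?dyadicI_01// glueR// glueL.
- by rewrite gE ?dyadicI_01// !glueR// ltW.
- move=> t Dt /andP[xt tx']; rewrite gE ?dyadicI_01// glueR// glueL//.
  by apply: c2 => //; case: Dt.
- move=> t Dt; rewrite negb_and -ltNge -leNgt gE ?dyadicI_01//.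
  case: (ltP t x) => [tx _|xt /= x't].
    by rewrite glueL// c1 ?subrr ?addr0 ?dyadicI_ge0//; case: Dt.
  rewrite !glueR// c3 ?cE ?subrr ?addr0//; first by case: Dt.
  exact: dyadicI_lt1.
Qed.

Lemma exists_local_shift x w z y : dyadicI x -> dyadicI w -> dyadicI z ->
  dyadicI y -> x < w -> w < z -> z < y -> col w = col z ->
  exists h : thompsonF R, [/\ h x = x, h w = z, h y = y,
    forall t, dyadicI t -> ~~ (x <= t < y) -> h t = t &
    forall t, dyadicI t -> col (h t) = col t].
Proof.
move=> Dx Dw Dz Dy xw wz zy cE; have wy := lt_trans wz zy; have xz := lt_trans xw wz.
have [dx /andP[x0 x1]] := Dx; have [dy /andP[y0 y1]] := Dy.
have [dw /andP[w0 w1]] := Dw; have [dz /andP[z0 z1]] := Dz.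
have d0 := dyadic0 R; have d1 := dyadic1 R.
have [f1 [P1 f1x f1w c1]] := color_iso_all dx dw dx dz (ltW x0) xw (ltW x0) xz.
have [f2 [P2 f2w f2y c2]] := color_iso_all dw dy dz dy (ltW w0) wy (ltW z0) zy.
have [|||g gE] := @thompson_of_pl (glue x id (glue w f1 (glue y f2 id))).
- apply: pl_glue; [exact: pl_id| |by rewrite glueL // f1x].
  apply: pl_glue => //; last by rewrite glueL // f1w f2w.
  by apply: pl_glue => //; exact: pl_id.
- by rewrite glueL.
- by rewrite !glueR // ltW // (lt_trans xw).
exists g; split.
- by rewrite gE ?dyadicI_01// glueR// glueL.
- by rewrite gE ?dyadicI_01// glueR ?(ltW xw)// glueR// glueL.
- by rewrite gE ?dyadicI_01// !glueR// ltW// (lt_trans xw).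
- move=> t Dt; rewrite negb_and -ltNge -leNgt gE ?dyadicI_01//.
  case: (ltP t x) => [tx _|xt /= yt]; first by rewrite glueL.
  by rewrite !glueR// (le_trans (ltW wy)).
- move=> t Dt; rewrite gE ?dyadicI_01//; have [dt _] := Dt.
  case: (ltP t x) => [tx|xt]; first by rewrite glueL.
  case: (ltP t w) => [tw|wt]; first by rewrite glueR// glueL// c1// subrr addr0.
  case: (ltP t y) => [ty|yt]; first by rewrite glueR// glueR// glueL// c2// cE subrr addr0.
  by rewrite !glueR.
Qed.

(** * Jones' subgroup preserves the colours *)

Definition bits_val (s : seq bool) : nat := foldl (fun n (d : bool) => (d + n.*2)%N) 0%N s.

Lemma bits_val_rcons s (d : bool) : bits_val (rcons s d) = (d + (bits_val s).*2)%N.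
Proof. by rewrite /bits_val foldl_rcons. Qed.

Lemma bits_fraction s : \sum_(j < size s) (nth false s j)%:R / 2 ^+ j.+1 =
  (bits_val s)%:R / 2 ^+ size s :> R.
Proof.
elim/last_ind: s => [|s d IH]; first by rewrite big_ord0 mul0r.
rewrite size_rcons big_ord_recr /= nth_rcons ltnn eqxx.
under eq_bigr => j _ do rewrite nth_rcons ltn_ord.
rewrite IH bits_val_rcons natrD -muln2 natrM exprS.
by field; rewrite pow2_neq0.
Qed.

Lemma bits_dsum s : (\sum_(j < size s) nth false s j = dsum (bits_val s))%N.
Proof.
elim/last_ind: s => [|s d IH]; first by rewrite big_ord0.
rewrite size_rcons big_ord_recr /= nth_rcons ltnn eqxx.
under eq_bigr => j _ do rewrite nth_rcons ltn_ord.
by rewrite IH bits_val_rcons dsum_bit addnC.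
Qed.

Lemma bits_exist N n : (n < 2 ^ N)%N -> exists2 s, size s = N & bits_val s = n.
Proof.
elim: N n => [|N IH] n nN; first by exists [::] => //; case: n nN.
have [|s sN sE] := IH n./2; first by move: nN; rewrite expnS; lia.
exists (rcons s (odd n)); first by rewrite size_rcons sN.
by rewrite bits_val_rcons sE odd_double_half.
Qed.

Lemma Fp_eqP (i j : nat) : (i = j %[mod p])%N <-> i%:R = j%:R :> 'F_p.
Proof.
split=> [E|/(congr1 val)]; last by rewrite /= !val_Fp_nat.
by rewrite -Fp_nat_mod// E Fp_nat_mod.
Qed.

Lemma digit_sum_classE i x : digit_sum_class p i x <-> dyadicI x /\ col x = i%:R.
Proof.
split=> [[Dx [s [E H]]]|[Dx cx]].
  by split=> //; rewrite E bits_fraction colorE; apply/Fp_eqP; rewrite -bits_dsum.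
split=> //; have [dx /andP[x0 x1]] := Dx.
have [N /(_ N (leqnn N)) [n E]] := dyadic_level dx (ltW x0).
move: x1 cx; rewrite E dyfrac_lt1 colorE => /bits_exist [s <- <-] cx.
by exists s; rewrite bits_fraction bits_dsum; split=> //; apply/Fp_eqP.
Qed.

Lemma jones_subgroupP (f : thompsonF R) : jones_subgroup R p f <->
  forall t, dyadicI t -> col (f t) = col t.
Proof.
split=> [Jf t Dt|H i _].
  pose i := val (col t).
  have ip : (i < p)%N by rewrite /i -[X in (_ < X)%N](Fp_cast p_prime) ltn_ord.
  have Si : digit_sum_class p i t by apply/digit_sum_classE; rewrite natr_Zp.
  have /digit_sum_classE[_ ->] : digit_sum_class p i (f t).
    by rewrite -(Jf i ip); exists t.
  by rewrite natr_Zp.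
apply/seteqP; split=> [_ [t /digit_sum_classE[Dt ct] <-]|t /digit_sum_classE[Dt ct]].
  apply/digit_sum_classE; rewrite H//; split=> //.
  exact: thompson_dyadicI (thompsonP f) _ Dt.
have Dv := thompson_inv_dyadicI (thompsonP f) Dt.
exists (thompson_inv (thompsonP f) t); last by rewrite thompsonVK.
by apply/digit_sum_classE; rewrite -H// thompsonVK.
Qed.

End Shift.

(** * Elements of Thompson's group shift colours by step functions *)

Section Steps.
Variables (R : realType) (p : nat).
Hypothesis p_prime : prime p.
Implicit Types (f g h k : thompsonF R) (a b t x y z : R) (c d l r : 'F_p).

Local Notation col := (@color R p).

Lemma F_mulE f g t : (f * g)%g t = f (g t). Proof. by []. Qed.

Lemma F_invK f t : (f^-1)%g (f t) = t.
Proof. exact: thompson_invK. Qed.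

Lemma F_Vinv f t : f ((f^-1)%g t) = t.
Proof. exact: thompsonVK. Qed.

Lemma F_dyadicI f t : dyadicI t -> dyadicI (f t).
Proof. by move=> Dt; have := thompson_dyadicI (thompsonP f) Dt. Qed.

Lemma F_lt f x y : dyadicI x -> dyadicI y -> (f x < f y) = (x < y).
Proof. by move=> Dx Dy; apply: (thompson_ltE (thompsonP f)); exact: dyadicI_01. Qed.

Lemma F_le f x y : dyadicI x -> dyadicI y -> (f x <= f y) = (x <= y).
Proof. by move=> Dx Dy; rewrite !leNgt F_lt. Qed.

Lemma dyadicI_between x y : 0 <= x -> x < y -> y <= 1 -> forall c,
  exists t, [/\ dyadicI t, x < t, t < y & col t = c].
Proof.
move=> x0 xy y1 c; have [t [dt xt ty tc]] := color_dense p_prime c x0 xy.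
exists t; split=> //; split=> //.
by rewrite (le_lt_trans x0 xt) (lt_le_trans ty y1).
Qed.

Lemma dyadicI_max x y : dyadicI x -> dyadicI y -> dyadicI (Num.max x y).
Proof. by rewrite /Num.max; case: ifP. Qed.

Lemma dyadicI_min x y : dyadicI x -> dyadicI y -> dyadicI (Num.min x y).
Proof. by rewrite /Num.min; case: ifP. Qed.

(** At a fine enough scale each cell lies in one affine piece and is mapped onto
    a cell, so that only a prefix of the binary expansions changes. *)
Lemma pl_cells (F : R -> R) a b : pl F a b -> 0 <= a -> 0 <= F a ->
  exists N0, forall N, (N0 <= N)%N -> forall i : nat,
    a <= i%:R / 2 ^+ N -> i.+1%:R / 2 ^+ N <= b ->
    exists d, forall t, dyadic t -> i%:R / 2 ^+ N <= t -> t < i.+1%:R / 2 ^+ N ->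
      col (F t) = col t + d.
Proof.
elim=> {a b} [a b k c da db ab [n [m cE]] fE|a m b P1 IH1 P2 IH2] a0 Fa0.
  exists (m + `|k|)%N => N HN i ai ib.
  pose M := `|N%:Z - k|%N.
  have kE : k = N%:Z - M%:Z by rewrite /M; lia.
  have mM : (m <= M)%N by rewrite /M; lia.
  have vE : 2 ^ k * (i%:R / 2 ^+ N) + c = (i%:Z + n * 2 ^+ (M - m))%:~R / 2 ^+ M.
    have E : 2 ^+ M = 2 ^+ m * 2 ^+ (M - m) :> R by rewrite -exprD subnKC.
    rewrite cE kE exprz2E intrD intrM rmorphXn /= E -pmulrn.
    by field; rewrite !pow2_neq0.
  have {vE} [j vE] : exists j : nat, 2 ^ k * (i%:R / 2 ^+ N) + c = j%:R / 2 ^+ M.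
    have : 0 <= 2 ^ k * (i%:R / 2 ^+ N) + c.
      rewrite (le_trans Fa0)// fE ?lexx ?(ltW ab)//.
      by rewrite lerD2r ler_pM2l ?exp2z_gt0.
    rewrite vE pmulr_lge0 ?pow2V_gt0// ler0z.
    by case: (_ + _) => // j _; exists j.
  exists ((dsum j)%:R - (dsum i)%:R) => t dt it ti.
  rewrite -(color_cell p j M dt it ti) -vE fE; last first.
    by rewrite (le_trans ai)//= (le_trans (ltW ti)).
  by congr color; rewrite -exprz2E -kE; ring.
have am := pl_lt P1; have mb := pl_lt P2.
have m0 : 0 <= m := le_trans a0 (ltW am).
have [N1 H1] := IH1 a0 Fa0.
have [N2 H2] := IH2 m0 (le_trans Fa0 (ltW (pl_incr P1 (lexx a) am (lexx m)))).
have [N3 H3] := dyadic_level (pl_dyadicr P1) m0.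
exists (maxn (maxn N1 N2) N3) => N HN i ai ib.
have [l lE] := H3 N ltac:(lia).
case: (ltnP i l) => il.
  by apply: (H1 N); rewrite ?lE ?ler_dyfrac//; lia.
by apply: (H2 N); rewrite ?lE ?ler_dyfrac//; lia.
Qed.

(** Only the number of jumps is recorded, not their list: it is invariant under
    the changes of variable of [steps_map], which move the jumps, and it is what
    the induction of [jones_overgroup] decreases. *)
Fixpoint steps n (D : R -> 'F_p) a : Prop :=
  if n is n'.+1 then
    exists b d, [/\ dyadicI b, a < b,
      forall t, dyadicI t -> a <= t < b -> D t = d & steps n' D b]
  else exists d, forall t, dyadicI t -> a <= t -> D t = d.

Definition delta f t : 'F_p := col (f t) - col t.

Lemma delta_steps f : exists n a,
  [/\ dyadicI a, forall t, dyadicI t -> t < a -> delta f t = 0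
    & steps n (delta f) a].
Proof.
have Ff := thompsonP f; have f0 := thompson0 Ff.
have [N0 HN] : exists N0, forall N, (N0 <= N)%N -> forall i : nat, (i < 2 ^ N)%N ->
    exists d, forall t, dyadic t -> i%:R / 2 ^+ N <= t -> t < i.+1%:R / 2 ^+ N ->
      delta f t = d.
  have [|N0 H] := pl_cells (thompson_plP Ff) (lexx 0); first by rewrite f0.
  exists N0 => N /H{H}H i iN; have [||d dP] := H i.
  - by rewrite divr_ge0 ?ler0n ?(ltW (pow2_gt0 _ _)).
  - by rewrite dyfrac_le1.
  by exists d => t dt it ti; rewrite /delta dP// addrC addKr.
have {HN N0} [N [N1 HN]] : exists N, (0 < N)%N /\ forall i : nat, (i < 2 ^ N)%N ->
    exists d, forall t, dyadic t -> i%:R / 2 ^+ N <= t -> t < i.+1%:R / 2 ^+ N ->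
      delta f t = d.
  by exists N0.+1; split=> //; exact: (HN _ (leqnSn _)).
have N2 : (1 < 2 ^ N)%N by rewrite -{1}(expn0 2) ltn_exp2l.
have Di i : (0 < i < 2 ^ N)%N -> dyadicI (i%:R / 2 ^+ N : R).
  move=> /andP[i0 iN]; split; first exact: dyadic_nat.
  by rewrite dyfrac_lt1 iN andbT divr_gt0 ?ltr0n ?pow2_gt0.
exists (2 ^ N - 2)%N, (1%:R / 2 ^+ N); split; first by apply: Di; rewrite N2.
  have [|d dP] := HN 0%N; first by lia.
  have d0 : d = 0.
    rewrite -(dP 0) ?mul0r ?divr_gt0 ?pow2_gt0// ?/delta ?f0 ?subrr//; exact: dyadic0.
  by move=> t [dt /andP[t0 _]] t1; rewrite -d0; apply: dP; rewrite ?mul0r ?ltW.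
suff H n i : (0 < i)%N -> (i + n.+1 = 2 ^ N)%N -> steps n (delta f) (i%:R / 2 ^+ N).
  by apply: H => //; lia.
elim: n i => [|n IH] i i0 iE.
  have [|d dP] := HN i; first by lia.
  exists d => t [dt /andP[_ t1]] it; apply: dP => //.
  by rewrite -addn1 iE natrX divff ?pow2_neq0.
have [|d dP] := HN i; first by lia.
exists (i.+1%:R / 2 ^+ N), d; split.
- by apply: Di; lia.
- by rewrite ltr_dyfrac.
- by move=> t [dt _] /andP[it ti]; apply: dP.
- by apply: IH => //; lia.
Qed.

Lemma steps_map g n (D D' : R -> 'F_p) a : dyadicI a ->
  (forall t, dyadicI t -> a <= t -> D' (g t) = D t) ->
  steps n D a -> steps n D' (g a).
Proof.
elim: n a => [|n IH] a Da DD' /=.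
  move=> [d dP]; exists d => t Dt at_.
  have Ds := F_dyadicI g^-1%g Dt.
  have as_ : a <= (g^-1)%g t by rewrite -(F_le g)// F_Vinv.
  by rewrite -(F_Vinv g t) DD'// dP.
move=> [b [d [Db ab dP sP]]]; exists (g b), d; split.
- exact: F_dyadicI.
- by rewrite F_lt.
- move=> t Dt /andP[at_ tb].
  have Ds := F_dyadicI g^-1%g Dt.
  have as_ : a <= (g^-1)%g t by rewrite -(F_le g)// F_Vinv.
  have sb : (g^-1)%g t < b by rewrite -(F_lt g)// F_Vinv.
  by rewrite -(F_Vinv g t) DD'// dP// as_.
- by apply: IH => // t Dt bt; apply: DD' => //; apply: le_trans bt; exact: ltW.
Qed.

(** Steps of value 0 are skipped; the next one begins at the jump sought. *)
Lemma first_jump n (D : R -> 'F_p) a : dyadicI a ->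
  (forall t, dyadicI t -> t < a -> D t = 0) -> steps n D a ->
  (exists2 t, dyadicI t & D t != 0) -> exists z y d,
  [/\ dyadicI z, dyadicI y, z < y, d != 0 &
    (forall t, dyadicI t -> t < z -> D t = 0) /\
    (forall t, dyadicI t -> z <= t < y -> D t = d)].
Proof.
elim: n a => [|n IH] a Da D0 /=.
  move=> [d dP] [t Dt Dt0].
  have ta : a <= t by rewrite leNgt; apply/negP => /(D0 t Dt)/eqP; apply/negP.
  have [y [Dy ay y1 _]] := dyadicI_between (dyadicI_ge0 Da) (dyadicI_lt1 Da) (lexx 1) 0.
  exists a, y, d; split=> //; first by rewrite -(dP t).
  by split=> // s Ds /andP[as_ _]; exact: dP.
move=> [b [d [Db ab dP sP]]] H; have [d0|dn0] := eqVneq d 0; last first.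
  by exists a, b, d.
apply: (IH b) => // t Dt tb; case: (ltP t a) => ta; first exact: D0.
by rewrite dP ?ta.
Qed.

(** * Overgroups of Jones' subgroup *)

Section Overgroup.
Variable L : set (thompsonF R).
Hypothesis L_group : is_subgroup L.
Hypothesis L_jones : jones_subgroup R p `<=` L.

Lemma L_mul f g : L f -> L g -> L (f * g)%g.
Proof.
by move=> Lf Lg; have := group_closedM L_group; move=> /(_ f g); rewrite !inE; exact.
Qed.

Lemma L_inv f : L f -> L f^-1%g.
Proof. by move=> Lf; have := group_closedV L_group; move=> /(_ f); rewrite !inE; exact. Qed.

Lemma L_col f : (forall t, dyadicI t -> col (f t) = col t) -> L f.
Proof. by move=> H; apply/L_jones/(jones_subgroupP p_prime). Qed.

Lemma L_1 : L 1%g. Proof. exact: L_col. Qed.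

Lemma jones_move x x' y y' : dyadicI x -> dyadicI x' -> dyadicI y -> dyadicI y' ->
  x < x' -> y < y' -> col x = col y -> col x' = col y' ->
  exists h, [/\ h x = y, h x' = y' & forall t, dyadicI t -> col (h t) = col t].
Proof.
move=> Dx Dx' Dy Dy' xx' yy' E E'.
have [h [hx hx' h1 h2]] := exists_shift p_prime Dx Dx' Dy Dy' xx' yy' E'.
exists h; split=> // t Dt; have [xt|xt] := boolP (x <= t < x'); last exact: h2.
by rewrite h1// E subrr addr0.
Qed.

Lemma jones_move1 x y : dyadicI x -> dyadicI y -> col x = col y ->
  exists h, h x = y /\ forall t, dyadicI t -> col (h t) = col t.
Proof.
move=> Dx Dy E.
have [z [Dz]] := dyadicI_between (dyadicI_ge0 (dyadicI_max Dx Dy))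
  (dyadicI_lt1 (dyadicI_max Dx Dy)) (lexx 1) 0.
rewrite gt_max => /andP[xz yz] _ _.
by have [h [hx _ hc]] := jones_move Dx Dz Dy Dz xz yz E (erefl _); exists h.
Qed.

(** Only the colour of the point is recorded, because colour preserving maps,
    which are in [L], act transitively on the points of a given colour. *)
Definition shift_germ c l r := exists f z x y,
  [/\ L f, dyadicI z /\ col z = c, dyadicI x /\ x < z, dyadicI y /\ z < y &
    (forall t, dyadicI t -> x <= t < z -> col (f t) = col t + l) /\
    (forall t, dyadicI t -> z <= t < y -> col (f t) = col t + r)].

(** Under the first germ the point gets the colour [c + r]; a colour preserving
    map then brings it to the base point of the second one. *)
Lemma shift_germ_mul c l r l' r' : shift_germ c l r -> shift_germ (c + r) l' r' ->
  shift_germ c (l + l') (r + r').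
Proof.
move=> [f [z [x [y [Lf [Dz cz] [Dx xz] [Dy zy] [fl fr]]]]]].
move=> [f' [z' [x' [y' [Lf' [Dz' cz'] [Dx' xz'] [Dy' zy'] [fl' fr']]]]]].
have Dfz := F_dyadicI f Dz.
have [h [hz hc]] : exists h, h (f z) = z' /\ forall t, dyadicI t -> col (h t) = col t.
  by apply: jones_move1 => //; rewrite fr ?lexx// cz cz'.
pose k := (h * f)%g.
have kz : k z = z' by rewrite /k F_mulE.
have Du := F_dyadicI k^-1%g Dx'; have Dv := F_dyadicI k^-1%g Dy'.
exists (f' * k)%g, z, (Num.max x (k^-1%g x')), (Num.min y (k^-1%g y')).
have kc t : dyadicI t -> col (k t) = col (f t).
  by move=> Dt; rewrite hc//; exact: F_dyadicI.
split=> //.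
- by apply: L_mul => //; apply: L_mul => //; exact: L_col.
- split; first exact: dyadicI_max.
  by rewrite gt_max xz /= -(F_lt k)// F_Vinv kz.
- split; first exact: dyadicI_min.
  by rewrite lt_min zy /= -(F_lt k)// F_Vinv kz.
- split=> t Dt.
    rewrite ge_max => /andP[/andP[xt ut] tz]; have Dkt := F_dyadicI k Dt.
    rewrite F_mulE fl'//; last first.
      by rewrite -(F_Vinv k x') -kz F_le ?F_lt// ut.
    by rewrite kc// fl ?xt// addrA.
  rewrite lt_min => /andP[zt /andP[ty tv]]; have Dkt := F_dyadicI k Dt.
  rewrite F_mulE fr'//; last first.
    by rewrite -(F_Vinv k y') -kz F_le ?F_lt// zt.
  by rewrite kc// fr ?zt// addrA.
Qed.

Lemma shift_germ_id c : shift_germ c 0 0.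
Proof.
have [z [Dz z0 z1 cz]] := dyadicI_between (lexx 0) ltr01 (lexx 1) c.
have [x [Dx x0 xz _]] := dyadicI_between (lexx 0) z0 (ltW z1) 0.
have [y [Dy zy y1 _]] := dyadicI_between (dyadicI_ge0 Dz) z1 (lexx 1) 0.
exists 1%g, z, x, y; split=> //; first exact: L_1.
by split=> t _ _; rewrite addr0.
Qed.

(** The colour shift of such an element is a multiple of the indicator function
    of [[z, z'[]. *)
Definition bump z z' y y' := exists g, [/\ L g, g z = y, g z' = y',
    forall t, dyadicI t -> z <= t < z' -> col (g t) = col t + (col y - col z) &
    forall t, dyadicI t -> ~~ (z <= t < z') -> col (g t) = col t].

Lemma bump_jones z z' y y' : dyadicI z -> dyadicI z' -> dyadicI y -> dyadicI y' ->
  z < z' -> y < y' -> col z = col y -> col z' = col y' -> bump z z' y y'.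
Proof.
move=> Dz Dz' Dy Dy' zz' yy' E E'.
have [h [hz hz' hc]] := jones_move Dz Dz' Dy Dy' zz' yy' E E'.
exists h; split=> //; first exact: L_col.
  by move=> t Dt _; rewrite hc// E subrr addr0.
by move=> t Dt _; exact: hc.
Qed.

Lemma bump_sym z z' y y' : dyadicI z -> dyadicI z' ->
  bump z z' y y' -> bump y y' z z'.
Proof.
move=> Dz Dz' [g [Lg gz gz' g1 g2]]; exists g^-1%g.
have H t : dyadicI t -> (y <= t < y') = (z <= g^-1%g t < z').
  by move=> Dt; have Ds := F_dyadicI g^-1%g Dt; rewrite -[z <= _](F_le g)// -[_ < z'](F_lt g)// gz gz' F_Vinv.
split; [exact: L_inv|by rewrite -gz F_invK|by rewrite -gz' F_invK| |] => t Dt;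
  have Ds := F_dyadicI g^-1%g Dt; rewrite H// => Ht.
  by rewrite -[in RHS](F_Vinv g t) g1//; ring.
by rewrite -[in RHS](F_Vinv g t) g2.
Qed.

Lemma bump_trans z z' y y' x x' : dyadicI z -> dyadicI z' ->
  bump z z' y y' -> bump y y' x x' -> bump z z' x x'.
Proof.
move=> Dz Dz' [f [Lf fz fz' f1 f2]] [g [Lg gy gy' g1 g2]].
have H t : dyadicI t -> (y <= f t < y') = (z <= t < z').
  by move=> Dt; rewrite -fz -fz' F_le ?F_lt.
exists (g * f)%g; split; rewrite ?F_mulE ?fz ?fz' //; first exact: L_mul.
  move=> t Dt tz; have Dft := F_dyadicI f Dt.
  by rewrite F_mulE g1 ?H// f1//; ring.
move=> t Dt tz; have Dft := F_dyadicI f Dt.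
by rewrite F_mulE g2 ?H// f2.
Qed.

(** If [f] shifts by [l] just before [z] and not after, and [h] preserves
    colours, moves [w < z] to [z] and lives near [z], then [f h f^-1] shifts
    only where [h] crosses [z]. *)
Lemma shift_germ_bump c l : shift_germ c l 0 -> exists z z' y y',
  [/\ [/\ dyadicI z, dyadicI z', dyadicI y & dyadicI y'],
     z < z', y < y', bump z z' y y' &
     [/\ col z = c + l, col z' = c, col y = c & col y' = c]].
Proof.
move=> [f [z [x [y [Lf [Dz cz] [Dx xz] [Dy zy] [fl fr]]]]]].
have [w [Dw xw wz cw]] := dyadicI_between (dyadicI_ge0 Dx) xz (ltW (dyadicI_lt1 Dz)) c.
have [|h [hx hw hy hout hc]] := exists_local_shift p_prime Dx Dw Dz Dy xw wz zy.
  by rewrite cw.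
have Lh : L h := L_col hc.
have Dhz := F_dyadicI h Dz.
have hz_y : h z < y by rewrite -hy F_lt.
have z_hz : z <= h z by rewrite -{1}hw F_le// ltW.
have cfz : col (f z) = c by rewrite fr ?lexx// addr0.
have cfw : col (f w) = c + l by rewrite fl ?(ltW xw)// cw.
exists (f w), (f z), (f z), (f (h z)); split.
- by split; exact: F_dyadicI.
- by rewrite F_lt.
- by rewrite F_lt// -{1}hw F_lt.
- exists (f * (h * f^-1))%g.
  have H t : dyadicI t -> (f w <= t < f z) = (w <= f^-1%g t < z).
    by move=> Dt; have Ds := F_dyadicI f^-1%g Dt; rewrite -[in LHS](F_Vinv f t) F_le ?F_lt.
  split; rewrite ?F_mulE ?F_invK ?hw//.
  + by apply: L_mul => //; apply: L_mul => //; exact: L_inv.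
  + move=> t Dt; rewrite H// !F_mulE -[in RHS](F_Vinv f t).
    have := F_dyadicI f^-1%g Dt; move: (f^-1%g t) => s Ds /andP[ws sz].
    have Dhs := F_dyadicI h Ds.
    rewrite fr//; last by rewrite -{1}hw F_le// ws (lt_trans _ hz_y)// F_lt.
    rewrite hc// fl//; last by rewrite sz (le_trans (ltW xw)).
    by rewrite cfz cfw; ring.
  + move=> t Dt; rewrite H// !F_mulE -[in RHS](F_Vinv f t).
    have := F_dyadicI f^-1%g Dt; move: (f^-1%g t) => s Ds.
    have Dhs := F_dyadicI h Ds.
    have [/andP[xs sy]|sout _] := boolP (x <= s < y); last by rewrite hout.
    rewrite negb_and -ltNge -leNgt; case: (ltP s w) => [sw _|ws /= zs].
      rewrite fl//; last by rewrite -{1}hx -hw F_le// F_lt// xs.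
      by rewrite hc// fl// xs (lt_trans sw).
    rewrite fr//; last by rewrite (le_trans z_hz) ?F_le//= -hy F_lt.
    by rewrite hc// fr// zs.
- by split=> //; rewrite fr ?hc ?addr0// z_hz.
Qed.

(** The colour shift of an element of [L] outside Jones' subgroup generates
    enough germs to have all bumps in [L]; these are used to remove one jump
    after the other from the shift of [k]. *)
Lemma jones_overgroup k0 : L k0 -> ~ jones_subgroup R p k0 ->
  forall k, (exists2 x, x < 1 & forall t, dyadicI t -> x <= t -> col (k t) = col t) ->
  L k.
Proof.
move=> Lk0 /(jones_subgroupP p_prime) Jk0.
have [z [y [d [Dz Dy zy dn0 [k0l k0r]]]]] : exists z y d,
  [/\ dyadicI z, dyadicI y, z < y, d != 0 &
    (forall t, dyadicI t -> t < z -> delta k0 t = 0) /\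
    (forall t, dyadicI t -> z <= t < y -> delta k0 t = d)].
  have [n [a [Da D0 sP]]] := delta_steps k0.
  apply: first_jump sP _ => //.
  apply: contrapT => H; apply: Jk0 => t Dt; apply/eqP; rewrite -subr_eq0.
  by apply/negPn/negP => Ht; apply: H; exists t.
have k0l' t : dyadicI t -> t < z -> col (k0 t) = col t + 0.
  by move=> Dt /(k0l t Dt); rewrite /delta => <-; rewrite addrC subrK.
have k0r' t : dyadicI t -> z <= t < y -> col (k0 t) = col t + d.
  by move=> Dt /(k0r t Dt); rewrite /delta => <-; rewrite addrC subrK.
(* Every colour occurs between [z] and [y]. *)
have germ_d c : shift_germ c d d.
  have [t [Dt zt ty tc]] := dyadicI_between (dyadicI_ge0 Dz) zy (ltW (dyadicI_lt1 Dy)) c.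
  exists k0, t, z, y; split=> //; split=> s Ds /andP[s1 s2]; apply: k0r' => //.
    by rewrite s1 (lt_trans s2).
  by rewrite s2 (le_trans (ltW zt)).
have germ_z : shift_germ (col z) 0 d.
  have [x [Dx x0 xz _]] := dyadicI_between (lexx 0) (proj1 (andP (proj2 Dz))) (ltW (dyadicI_lt1 Dz)) 0.
  by exists k0, z, x, y; split=> //; split=> [t Dt /andP[_]|]; [exact: k0l'|exact: k0r'].
have span e : exists n, e = d *+ n.
  by exists (val (e / d)); rewrite -mulr_natr natr_Zp mulrC divfK.
have germ_diag c e : shift_germ c e e.
  have [n ->] := span e; elim: n => [|n IH] in c *; first by rewrite mulr0n; exact: shift_germ_id.
  by rewrite mulrS; apply: shift_germ_mul.
(* Conjugating by diagonal germs transports the jump from [z] to any colour. *)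
have germ_0d c : shift_germ c 0 d.
  have := shift_germ_mul (shift_germ_mul (germ_diag c (col z - c)) (l' := 0) (r' := d) _)
    (germ_diag _ (c - col z)).
  rewrite [c + (col z - c)]addrC subrK => /(_ germ_z).
  have -> : col z - c + 0 + (c - col z) = 0 by ring.
  by have -> : col z - c + d + (c - col z) = d by ring.
have germ_Nd c : shift_germ c (- d) 0.
  by have := shift_germ_mul (germ_0d c) (germ_diag _ (- d)); rewrite add0r subrr.
have germ_left c l : shift_germ c l 0.
  have [n ] := span (- l); move/(canRL opprK)->; rewrite -mulNrn.
  elim: n => [|n IH]; first by rewrite mulr0n; exact: shift_germ_id.
  by rewrite mulrS -[0]addr0; apply: shift_germ_mul => //; rewrite addr0.
(* Both sides reduce to a pair of points having the colour of [b]. *)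
have bump_all a b a2 b2 : dyadicI a -> dyadicI b -> dyadicI a2 -> dyadicI b2 ->
    a < b -> a2 < b2 -> col b = col b2 -> bump a b a2 b2.
  move=> Da Db Da2 Db2 ab ab2 E.
  have H u v : dyadicI u -> dyadicI v -> u < v -> exists s s',
      [/\ dyadicI s, dyadicI s', s < s', bump u v s s' & col s = col v /\ col s' = col v].
    move=> Du Dv uv.
    have [u1 [v1 [s [s' [[? ? ? ?] uv1 ss' B [c1 c2 c3 c4]]]]]] :=
      shift_germ_bump (germ_left (col v) (col u - col v)).
    exists s, s'; split=> //; apply: bump_trans B => //; apply: bump_jones => //.
    by rewrite c1 addrC subrK.
  have [s [s' [Ds Ds' ss' B [c1 c2]]]] := H a b Da Db ab.
  have [r [r' [Dr Dr' rr' B' [c1' c2']]]] := H a2 b2 Da2 Db2 ab2.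
  apply: bump_trans B _ => //; apply: (@bump_trans _ _ r r') => //; last exact: bump_sym.
  by apply: bump_jones => //; rewrite ?c1 ?c2 E.
move=> k [x x1 kx]; have [n [a [Da kz sP]]] := delta_steps k.
elim: n => [|n IH] in k x x1 kx a Da kz sP *; move: sP => /=.
  move=> [e eP]; apply: L_col => t Dt; apply/eqP; rewrite -subr_eq0.
  case: (ltP t a) => ta; first by apply/eqP/kz.
  (* The constant is 0 because [k] preserves the colours near 1. *)
  have max1 : Num.max x a < 1 by rewrite gt_max x1 dyadicI_lt1.
  have max0 : 0 <= Num.max x a by rewrite le_max (dyadicI_ge0 Da) orbT.
  have [s [Ds]] := dyadicI_between max0 max1 (lexx 1) 0.
  rewrite gt_max => /andP[xs as_] _ _.
  rewrite -[_ - _]/(delta k t) (eP t)// -(eP s) ?(ltW as_)//.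
  by rewrite /delta kx ?subrr// ltW.
move=> [b [e [Db ab eP sP]]].
have [a2 [Da2 a20 a21 ca2]] := dyadicI_between (lexx 0) ltr01 (lexx 1) (col a + e).
have [b2 [Db2 ab2 b21 cb2]] := dyadicI_between (ltW a20) a21 (lexx 1) (col b).
have [g [Lg ga gb g1 g2]] := bump_all _ _ _ _ Da Db Da2 Db2 ab ab2 (esym cb2).
have {}g1 t : dyadicI t -> a <= t < b -> delta g t = e.
  by move=> Dt tab; rewrite /delta g1// ca2; ring.
have {}g2 t : dyadicI t -> ~~ (a <= t < b) -> delta g t = 0.
  by move=> Dt tab; rewrite /delta g2// subrr.
(* The shift of [k / g] is 0 up to [g b], and has one jump less. *)
rewrite -(mulgVK g k); apply: (L_mul _ Lg).
have kg t : dyadicI t -> delta (k / g)%g (g t) = delta k t - delta g t.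
  by move=> Dt; rewrite /delta F_mulE F_invK; ring.
have max1 : Num.max x b < 1 by rewrite gt_max x1 dyadicI_lt1.
have max0 : 0 <= Num.max x b by rewrite le_max (dyadicI_ge0 Db) orbT.
have [s [Ds]] := dyadicI_between max0 max1 (lexx 1) 0.
rewrite gt_max => /andP[xs bs] _ _.
have H t : dyadicI t -> delta (k / g)%g t = delta k (g^-1%g t) - delta g (g^-1%g t).
  by move=> Dt; rewrite -kg ?F_Vinv//; exact: F_dyadicI.
apply: (IH _ (g s) _ _ (g b)).
- exact/dyadicI_lt1/F_dyadicI.
- move=> t Dt st; apply/eqP; rewrite -subr_eq0 -[_ - _]/(delta _ _) H//.
  have Du := F_dyadicI g^-1%g Dt.
  have su : s <= g^-1%g t by rewrite -(F_le g)// F_Vinv.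
  rewrite g2//; last by rewrite negb_and -leNgt (le_trans (ltW bs) su) orbT.
  by rewrite /delta kx ?subrr// (le_trans (ltW xs)).
- exact: F_dyadicI.
- move=> t Dt tb; rewrite H//; have Du := F_dyadicI g^-1%g Dt.
  have ub : g^-1%g t < b by rewrite -(F_lt g)// F_Vinv.
  case: (ltP (g^-1%g t) a) => [ua|au].
    by rewrite kz// g2 ?subrr// negb_and -ltNge ua.
  by rewrite eP ?au// g1 ?au// subrr.
- apply: (steps_map (g := g)) sP => // t Dt bt; rewrite kg// g2 ?subr0//.
  by rewrite negb_and -leNgt bt orbT.
Qed.

End Overgroup.
End Steps.

(** * Germs at 1 *)

Section GermOne.
Variable R : realType.
Implicit Types (f g h : R -> R) (x y t w v : R) (m : int).

Definition slope_at1 f m := exists N : nat,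
  forall x, 1 - (2 ^+ N)^-1 <= x <= 1 -> f x = 1 - 2 ^ m * (1 - x).

Lemma thompson_slope_at1 f : is_thompson f -> exists m, slope_at1 f m.
Proof.
move=> Ff; have [a [k [c [a0 a1 fE]]]] := pl_last (thompson_plP Ff).
have [N /(_ N (leqnn N)) HN] : exists N, forall n, (N <= n)%N -> (2 ^+ n)^-1 < 1 - a.
  by apply: pow2V_small; rewrite subr_gt0.
have f1 : 1 = 2 ^ k * 1 + c.
  by rewrite -fE ?lexx ?andbT ?ltW// (thompson1 Ff).
exists k, N => x /andP[x0 x1]; rewrite fE; first by rewrite [X in X - _]f1; ring.
by rewrite x1 andbT; move: HN x0; lra.
Qed.

(** The cell with right end 1 and length [2 ^ - n], of colour [n], is mapped to
    the one of length [2 ^ (m - n)], of colour [n - m]. *)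
Lemma slope_at1_color p (p_prime : prime p) f m : slope_at1 f m -> exists2 a, a < 1 &
  forall t, dyadicI t -> a <= t -> color p (f t) = color p t - m%:~R.
Proof.
move=> [N fE].
pose n := (N + `|m|)%N; pose n' := `|n%:Z - m|%N.
have mE : m = n%:Z - n'%:Z by rewrite /n' /n; lia.
exists (1 - (2 ^+ n)^-1); first by rewrite ltrBlDr ltrDl invr_gt0 pow2_gt0.
move=> t [dt /andP[t0 t1]] nt.
have cE := @color_cell R p (2 ^ n).-1 n (2 ^ n').-1 n' t dt.
have Nt : 1 - (2 ^+ N)^-1 <= t.
  apply: le_trans nt; rewrite lerD2l lerN2 lef_pV2 ?posrE ?pow2_gt0//.
  by rewrite ler_eXn2l ?ltr1n// leq_addr.
rewrite fE ?Nt ?(ltW t1)//.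
move: cE; rewrite prednK ?expn_gt0// !dyfrac_mersenne natrX divff ?pow2_neq0//.
move=> /(_ nt t1); rewrite !dsum_mersenne => E.
have -> : - m%:~R = n'%:R - n%:R :> 'F_p by rewrite mE intrB opprB -!pmulrn.
by rewrite -E; congr color; rewrite mE exprz2E; field; rewrite !pow2_neq0.
Qed.

(** [h] conjugates the scaling of ratio [2 ^ - a] at 1 to that of ratio
    [2 ^ - b], and is dyadic piecewise linear away from 1. *)
Record rescales (a b : nat) h : Prop := Rescales {
  rescales_in : forall x, 0 <= x < 1 -> 0 <= h x < 1;
  rescales_out : forall x, ~~ (0 <= x < 1) -> h x = x;
  rescales_scale : forall n x, 0 <= x < 1 ->
    h (1 - (1 - x) / 2 ^+ (a * n)) = 1 - (1 - h x) / 2 ^+ (b * n);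
  rescales_pl : forall n, (0 < n)%N -> pl h 0 (1 - (2 ^+ (a * n))^-1) }.

Lemma pow2V_le1 n : (2 ^+ n)^-1 <= 1 :> R.
Proof. by rewrite invf_le1 ?pow2_gt0// exprn_ege1// ler1n. Qed.


Lemma rescales_inv a b h g : rescales a b h -> cancel h g -> cancel g h ->
  h 0 = 0 -> rescales b a g.
Proof.
move=> H hg gh h0.
have z01 : 0 <= (0 : R) < 1 by rewrite lexx ltr01.
have gin x : 0 <= x < 1 -> 0 <= g x < 1.
  move=> x01; apply/negPn/negP => N; have := rescales_out H N.
  by rewrite gh => E; move: N; rewrite -E x01.
have gout x : ~~ (0 <= x < 1) -> g x = x.
  by move=> N; rewrite -{1}(rescales_out H N) hg.
have Sc n x : 0 <= x < 1 -> g (1 - (1 - x) / 2 ^+ (b * n)) = 1 - (1 - g x) / 2 ^+ (a * n).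
  by move=> x01; rewrite -{1}(gh x) -(rescales_scale H) ?gin// hg.
split=> // n n0.
have := pl_inv (rescales_pl H n0) (fun x _ => hg x).
by have := rescales_scale H n z01; rewrite h0 subr0 !div1r => ->.
Qed.

(** Away from 1 the conjugate is a composition of piecewise linear maps; near 1
    the scaling relations show that it is affine. *)
Lemma rescales_conj a b h g f m : (0 < a)%N -> rescales a b h -> cancel h g -> cancel g h ->
  h 0 = 0 -> is_thompson f -> slope_at1 f (a%:Z * m) ->
  is_thompson (h \o f \o g) /\ slope_at1 (h \o f \o g) (b%:Z * m).
Proof.
move=> a0 H hg gh h0 Ff [N fE].
have G := rescales_inv H hg gh h0.
have g0 : g 0 = 0 by rewrite -{1}h0 hg.
have z01 : 0 <= (0 : R) < 1 by rewrite lexx ltr01.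
have n1 : ~~ (0 <= (1 : R) < 1) by rewrite ltxx andbF.
have h1 : h 1 = 1 by exact: rescales_out H _ n1.
have g1 : g 1 = 1 by exact: rescales_out G _ n1.
have f0 := thompson0 Ff; have f1 := thompson1 Ff.
pose n := (N + `|m| + 1)%N; pose n' := `|n%:Z - m|%N.
have mE : m = n%:Z - n'%:Z by rewrite /n' /n; lia.
have n_gt0 : (0 < n)%N by rewrite /n; lia.
have n'_gt0 : (0 < n')%N by rewrite /n' /n; lia.
have amE e : 2 ^ (e%:Z * m) = 2 ^+ (e * n) / 2 ^+ (e * n') :> R.
  by rewrite mE mulrBr -!PoszM exprz2E.
have fs x : 0 <= x < 1 ->
    f (1 - (1 - x) / 2 ^+ (a * n)) = 1 - (1 - x) / 2 ^+ (a * n').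
  move=> /andP[x0 x1]; rewrite fE.
    by rewrite amE; field; rewrite !pow2_neq0.
  rewrite lerD2l lerN2 lerBlDr lerDl divr_ge0 ?subr_ge0 ?(ltW x1) ?(ltW (pow2_gt0 _ _))// andbT.
  apply: (@le_trans _ _ (2 ^+ (a * n))^-1).
    by rewrite ler_pdivrMr ?pow2_gt0// mulVf ?pow2_neq0// lerBlDr lerDl.
  rewrite lef_pV2 ?posrE ?pow2_gt0// ler_eXn2l ?ltr1n//.
  by rewrite /n; move: a0; clear; nia.
have sc0 e r k : rescales e r k -> k 0 = 0 -> forall l,
    k (1 - (2 ^+ (e * l))^-1) = 1 - (2 ^+ (r * l))^-1.
  by move=> K k0 l; have := rescales_scale K l z01; rewrite k0 subr0 !div1r.
have fsz : f (1 - (2 ^+ (a * n))^-1) = 1 - (2 ^+ (a * n'))^-1.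
  by have := fs 0 z01; rewrite subr0 !div1r.
have phiE y : 1 - (2 ^+ (b * n))^-1 <= y <= 1 ->
    (h \o f \o g) y = 1 - 2 ^ (b%:Z * m) * (1 - y).
  move=> /andP[y0]; rewrite le_eqVlt => /predU1P[->|y1] /=.
    by rewrite g1 f1 h1 subrr mulr0 subr0.
  pose y' := 1 - (1 - y) * 2 ^+ (b * n).
  have y'01 : 0 <= y' < 1.
    rewrite /y' subr_ge0 ltrBlDr ltrDl mulr_gt0 ?subr_gt0 ?pow2_gt0// andbT.
    by rewrite -ler_pdivlMr ?pow2_gt0// div1r lerBlDr addrC -lerBlDr.
  have -> : y = 1 - (1 - y') / 2 ^+ (b * n) by rewrite /y'; field; rewrite pow2_neq0.
  rewrite (rescales_scale G)// fs; last exact: rescales_in G _ y'01.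
  rewrite (rescales_scale H)//; last exact: rescales_in G _ y'01.
  by rewrite gh amE; field; rewrite !pow2_neq0.
have dV k : dyadic ((2 ^+ k)^-1 : R) by rewrite -[_^-1]mul1r; exact: (dyadic_nat R 1 k).
have lt1V k : 1 - (2 ^+ k)^-1 < 1 :> R by rewrite ltrBlDr ltrDl invr_gt0 pow2_gt0.
split; last by exists (b * n)%N.
apply: pl_thompson => /=.
- apply: (@pl_cat _ _ _ (1 - (2 ^+ (b * n))^-1)).
    have Pg := rescales_pl G n_gt0.
    apply: (pl_comp Pg); rewrite g0 (sc0 _ _ _ G g0).
    have Pf : pl f 0 (1 - (2 ^+ (a * n))^-1).
      apply: (pl_sub (thompson_plP Ff)) => //.
      + exact: dyadic0.
      + by apply: dyadicB; [exact: dyadic1|].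
      + by rewrite subr_gt0 invf_lt1 ?pow2_gt0// exprn_egt1 ?ltr1n// -lt0n muln_gt0 a0.
      + exact: ltW.
    by apply: (pl_comp Pf); rewrite f0 fsz; exact: (rescales_pl H n'_gt0).
  apply: (@pl_affine _ _ _ _ (b%:Z * m) (1 - 2 ^ (b%:Z * m))) => //.
  + by apply: dyadicB; [exact: dyadic1|].
  + exact: dyadic1.
  + by apply: dyadicB; [|rewrite -[_ ^ _]mulr1; apply: dyadicZ]; exact: dyadic1.
  + by move=> x /phiE->; ring.
- by rewrite g0 f0 h0.
- by rewrite g1 f1 h1.
move=> x xN.
have xN' : ~~ (0 <= x < 1).
  by apply: contra xN => /andP[-> x1]; rewrite ltW.
by rewrite (rescales_out G)// (thompson_out Ff)// (rescales_out H).
Qed.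

End GermOne.

(** * A homeomorphism conjugating Thompson's group to a finite index subgroup *)

Section Extend.
Variable R : realType.
Implicit Types (x y t w v : R).

Definition scale_index (q : nat) y : nat :=
  xget 0%N [set k | (2 ^+ q)^-1 < 2 ^+ (q * k) * y <= 1].

(** Extends [F : ]2^-q, 1] -> ]2^-r, 1]] to []0, 1]] so that multiplying the
    argument by [2 ^ - q] multiplies the value by [2 ^ - r]. *)
Definition extend (q r : nat) (F : R -> R) y :=
  F (2 ^+ (q * scale_index q y) * y) / 2 ^+ (r * scale_index q y).

Lemma scale_indexP q y : (0 < q)%N -> 0 < y <= 1 ->
  (2 ^+ q)^-1 < 2 ^+ (q * scale_index q y) * y <= 1.
Proof.
move=> q0 /andP[y0 y1]; rewrite /scale_index.
case: xgetP => [k _ //|/= H]; exfalso.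
have [N0 /(_ N0 (leqnn _)) HN] := pow2V_small y0.
have E k : 2 ^+ (q * k) * y <= 1.
  elim: k => [|k IH]; first by rewrite muln0 mul1r.
  rewrite leNgt; apply/negP => H'; apply: (H k); rewrite IH andbT.
  by rewrite -div1r ltr_pdivrMr ?pow2_gt0// mulrC mulrA -exprD -mulnS.
have := E N0; rewrite leNgt => /negP; apply.
rewrite mulrC -ltr_pdivrMr ?pow2_gt0// div1r.
apply: le_lt_trans HN; rewrite lef_pV2 ?posrE ?pow2_gt0//.
by rewrite ler_eXn2l ?ltr1n// leq_pmull.
Qed.

Lemma scale_index_eq q k y : (0 < q)%N -> (2 ^+ q)^-1 < 2 ^+ (q * k) * y <= 1 -> scale_index q y = k.
Proof.
move=> q0 /andP[k1 k2].
have y0 : 0 < y.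
  by have := lt_trans (pow2V_gt0 R q) k1; rewrite pmulr_rgt0 ?pow2_gt0.
have y1 : y <= 1.
  by apply: le_trans k2; rewrite ler_peMl ?(ltW y0)// exprn_ege1// ler1n.
have /andP[l1 l2] := scale_indexP q0 (introT andP (conj y0 y1)).
have H i j : (i < j)%N -> (2 ^+ q)^-1 < 2 ^+ (q * i) * y -> 1 < 2 ^+ (q * j) * y.
  move=> ij; rewrite -div1r ltr_pdivrMr ?pow2_gt0// mulrC mulrA -exprD -mulnS => H.
  apply: lt_le_trans H _; rewrite ler_pM2r// ler_eXn2l ?ltr1n//.
  by rewrite leq_mul2l ij orbT.
case: (ltngtP (scale_index q y) k) => // lk.
  by have := H _ _ lk l1; rewrite ltNge k2.
by have := H _ _ lk k1; rewrite ltNge l2.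
Qed.

Variables (q r : nat) (F : R -> R).
Hypothesis q_gt0 : (0 < q)%N.
Hypothesis r_gt0 : (0 < r)%N.
Hypothesis F_in : forall w, (2 ^+ q)^-1 < w <= 1 -> (2 ^+ r)^-1 < F w <= 1.

Lemma extendE k y : (2 ^+ q)^-1 < 2 ^+ (q * k) * y <= 1 ->
  extend q r F y = F (2 ^+ (q * k) * y) / 2 ^+ (r * k).
Proof. by move=> H; rewrite /extend (scale_index_eq q_gt0 H). Qed.

Lemma extend_in y : 0 < y <= 1 -> 0 < extend q r F y <= 1.
Proof.
move=> /(scale_indexP q_gt0)/F_in/andP[F1 F2]; rewrite /extend.
have F0 := lt_trans (pow2V_gt0 R r) F1.
rewrite divr_gt0 ?pow2_gt0//= ler_pdivrMr ?pow2_gt0// mul1r.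
by rewrite (le_trans F2)// exprn_ege1// ler1n.
Qed.

Lemma extend_scale n y : 0 < y <= 1 ->
  extend q r F (y / 2 ^+ (q * n)) = extend q r F y / 2 ^+ (r * n).
Proof.
move=> /(scale_indexP q_gt0) H; rewrite {2}/extend.
have E : 2 ^+ (q * (scale_index q y + n)) * (y / 2 ^+ (q * n)) = 2 ^+ (q * scale_index q y) * y.
  by rewrite mulnDr exprD; field; rewrite pow2_neq0.
rewrite (@extendE (scale_index q y + n)) E// mulnDr exprD.
by field; rewrite !pow2_neq0.
Qed.

End Extend.

Lemma extendK (R : realType) q r (F G : R -> R) : (0 < q)%N -> (0 < r)%N ->
  (forall w, (2 ^+ q)^-1 < w <= 1 -> (2 ^+ r)^-1 < F w <= 1) ->
  (forall w, (2 ^+ q)^-1 < w <= 1 -> G (F w) = w) ->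
  forall y, 0 < y <= 1 -> extend r q G (extend q r F y) = y.
Proof.
move=> q0 r0 Fin FK y /(scale_indexP q0) H; have FH := Fin _ H.
have E : 2 ^+ (r * scale_index q y) * extend q r F y = F (2 ^+ (q * scale_index q y) * y).
  by rewrite /extend mulrC divfK ?pow2_neq0.
rewrite (@extendE _ r q G r0 (scale_index q y)) E// FK// mulrC mulKf ?pow2_neq0//.
Qed.


Section Flip.
Variable R : realType.
Implicit Types (x y : R) (F G : R -> R).

(** The breakpoints of [extend] accumulate at 0, those of [flip_extend] at 1. *)
Definition flip_extend q r F x : R :=
  if 0 <= x < 1 then 1 - extend q r F (1 - x) else x.

Lemma flip01 x : (0 < 1 - x <= 1) = (0 <= x < 1).
Proof. by rewrite subr_gt0 lerBlDr lerDl andbC. Qed.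

Lemma flip_extendE q r F x : 0 <= x < 1 -> flip_extend q r F x = 1 - extend q r F (1 - x).
Proof. by rewrite /flip_extend => ->. Qed.

Lemma flip_extend_in q r F x : (0 < q)%N ->
  (forall w, (2 ^+ q)^-1 < w <= 1 -> (2 ^+ r)^-1 < F w <= 1) ->
  0 <= x < 1 -> 0 <= flip_extend q r F x < 1.
Proof.
move=> q0 Fin x01; rewrite flip_extendE// -flip01 subKr.
by apply: extend_in => //; rewrite flip01.
Qed.

Lemma flip_extendK q r F G : (0 < q)%N -> (0 < r)%N ->
  (forall w, (2 ^+ q)^-1 < w <= 1 -> (2 ^+ r)^-1 < F w <= 1) ->
  (forall w, (2 ^+ q)^-1 < w <= 1 -> G (F w) = w) ->
  cancel (flip_extend q r F) (flip_extend r q G).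
Proof.
move=> q0 r0 Fin FK x; have [x01|xN] := boolP (0 <= x < 1).
  rewrite flip_extendE; last exact: flip_extend_in.
  by rewrite flip_extendE// subKr (extendK q0 r0 Fin FK) ?flip01// subKr.
by rewrite /flip_extend (negbTE xN) (negbTE xN).
Qed.

Lemma flip_extend_scale q r F n x : (0 < q)%N -> 0 <= x < 1 ->
  flip_extend q r F (1 - (1 - x) / 2 ^+ (q * n)) =
  1 - (1 - flip_extend q r F x) / 2 ^+ (r * n).
Proof.
move=> q0 x01; have /andP[y0 y1] : 0 < 1 - x <= 1 by rewrite flip01.
rewrite !flip_extendE//.
  by rewrite !subKr extend_scale ?flip01.
rewrite -flip01 subKr divr_gt0 ?pow2_gt0//= ler_pdivrMr ?pow2_gt0// mul1r.
by rewrite (le_trans y1)// exprn_ege1// ler1n.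
Qed.

End Flip.

Section Rescaling.
Variables (R : realType) (p : nat).
Hypothesis p_gt1 : (1 < p)%N.
Implicit Types (x y t w v : R).

Local Notation e := ((2 ^+ p)^-1 : R).

(** An increasing map of [[1/2, 1]] onto [[2^-p, 1]], with slopes 1 and 2 and a
    breakpoint at [1/2 + 2^-p]. *)
Definition block w : R := Num.max (2 * w - 1) (w - 1 / 2 + e).

Definition block_inv v : R := Num.min ((v + 1) / 2) (v + 1 / 2 - e).

Definition rescaling := flip_extend 1 p block.

Definition rescaling_inv := flip_extend p 1 block_inv.

Lemma e_bounds : 0 < e /\ e <= 1 / 4.
Proof.
split; first exact: pow2V_gt0.
have -> : 1 / 4 = (2 ^+ 2)^-1 :> R by field.
by rewrite lef_pV2 ?posrE ?pow2_gt0// ler_eXn2l ?ltr1n.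
Qed.

Lemma block_in w : (2 ^+ 1)^-1 < w <= 1 -> e < block w <= 1.
Proof.
have [e0 e4] := e_bounds; rewrite expr1 => /andP[w1 w2].
by rewrite /block /Num.max; case: (ltP (2 * w - 1)) => H; apply/andP; split; move: H w1 w2; lra.
Qed.

Lemma block_inv_in v : e < v <= 1 -> (2 ^+ 1)^-1 < block_inv v <= 1.
Proof.
have [e0 e4] := e_bounds; rewrite expr1 => /andP[v1 v2].
by rewrite /block_inv /Num.min; case: (ltP ((v + 1) / 2)) => H; apply/andP; split; move: H v1 v2; lra.
Qed.

Lemma blockK w : block_inv (block w) = w.
Proof.
rewrite /block /Num.max; case: (ltP (2 * w - 1)) => H; rewrite /block_inv /Num.min;
  by case: (ltP ((_ + 1) / 2)) => H'; move: H H'; lra.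
Qed.

Lemma block_invK v : block (block_inv v) = v.
Proof.
rewrite /block_inv /Num.min; case: (ltP ((v + 1) / 2)) => H; rewrite /block /Num.max;
  by case: (ltP (2 * _ - 1)) => H'; move: H H'; lra.
Qed.

Let p_gt0 : (0 < p)%N. Proof. exact: ltnW. Qed.

Lemma rescalingK : cancel rescaling rescaling_inv.
Proof. by apply: (flip_extendK _ p_gt0 block_in) => // w _; exact: blockK. Qed.

Lemma rescaling_invK : cancel rescaling_inv rescaling.
Proof. by apply: (flip_extendK p_gt0 _ block_inv_in) => // w _; exact: block_invK. Qed.

Lemma rescalingE k x : 1 - (2 ^+ k)^-1 <= x <= 1 - (2 ^+ k.+1)^-1 ->
  rescaling x = 1 - block (2 ^+ k * (1 - x)) / 2 ^+ (p * k).
Proof.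
move=> /andP[xl xr].
have k0 := pow2V_gt0 R k.+1.
have x01 : 0 <= x < 1.
  apply/andP; split; last by move: xr k0; lra.
  by apply: le_trans xl; rewrite subr_ge0 pow2V_le1.
have w1 : 2 ^+ k * (1 - x) <= 1.
  by rewrite mulrC -ler_pdivlMr ?pow2_gt0// div1r; move: xl; lra.
have w2 : 1 / 2 <= 2 ^+ k * (1 - x).
  rewrite ler_pdivrMr// mulrAC -exprSr mulrC -ler_pdivrMr ?pow2_gt0// div1r.
  by move: xr; lra.
rewrite /rescaling flip_extendE//; congr (1 - _).
(* At the right end [x] is in the next block, where the value is the same. *)
move: w2; rewrite le_eqVlt => /predU1P[w2|w2]; last first.
  by rewrite (@extendE _ 1 p block isT k) !mul1n//expr1 -div1r w2.
have E : 2 ^+ (1 * k.+1) * (1 - x) = 1.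
  by rewrite mul1n exprS -mulrA -w2; field.
rewrite (@extendE _ 1 p block isT k.+1) E -?w2 ?expr1; last first.
  by rewrite lexx andbT invf_lt1 ?ltr1n.
have [e0 e4] := e_bounds.
have -> : block 1 = 1 by rewrite /block /Num.max; case: ltP; move: e0 e4; lra.
have -> : block (1 / 2) = e by rewrite /block /Num.max; case: ltP; move: e0 e4; lra.
by rewrite mulnS exprD; field; rewrite !pow2_neq0.
Qed.

Lemma rescaling_pl_block k : pl rescaling (1 - (2 ^+ k)^-1) (1 - (2 ^+ k.+1)^-1).
Proof.
have [e0 e4] := e_bounds.
have dV i : dyadic ((2 ^+ i)^-1 : R) by rewrite -[_^-1]mul1r; exact: (dyadic_nat R 1 i).
have d1 := dyadic1 R.
pose c : R := 1 - (1 / 2 + e) / 2 ^+ k.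
have ek : 0 < (2 ^+ k)^-1 :> R := pow2V_gt0 R k.
have S : (2 ^+ k.+1)^-1 = (2 ^+ k)^-1 / 2 :> R by rewrite exprS; field; rewrite pow2_neq0.
have dc : dyadic c.
  have -> : c = 1 - (2 ^+ k.+1)^-1 - (2 ^+ (p + k))^-1.
    by rewrite /c exprS exprD; field; rewrite !pow2_neq0.
  by do 2!apply: dyadicB => //.
have lc : 1 - (2 ^+ k)^-1 < c.
  rewrite /c ltrD2l ltrN2 ltr_pdivrMr ?pow2_gt0// mulVf ?pow2_neq0//.
  by move: e4; lra.
have cr : c < 1 - (2 ^+ k.+1)^-1.
  rewrite /c ltrD2l ltrN2 S [ltRHS]mulrC ltr_pM2l//.
  by move: e0; lra.
have wc x : x <= c -> 1 / 2 + e <= 2 ^+ k * (1 - x).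
  move=> xc; rewrite [leRHS]mulrC -ler_pdivrMr ?pow2_gt0//.
  by rewrite lerBrDr addrC -lerBrDr.
have wc' x : c <= x -> 2 ^+ k * (1 - x) <= 1 / 2 + e.
  move=> xc; rewrite [leLHS]mulrC -ler_pdivlMr ?pow2_gt0//.
  by rewrite lerBlDr addrC -lerBlDr.
have dz (i : int) : dyadic (2 ^ i : R) by rewrite -[_ ^ _]mulr1; exact: dyadicZ.
apply: (@pl_cat _ _ _ c).
  apply: (@pl_affine _ _ _ _ (k.+1%:Z - (p * k)%:Z)
    (1 + (2 ^+ (p * k))^-1 - 2 ^ (k.+1%:Z - (p * k)%:Z))) => //.
  - exact: dyadicB.
  - by apply: dyadicB => //; exact: dyadicD.
  move=> x /andP[x1 x2]; rewrite (@rescalingE k) ?x1 ?(le_trans x2 (ltW cr))//.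
  have -> : block (2 ^+ k * (1 - x)) = 2 * (2 ^+ k * (1 - x)) - 1.
    by have := wc _ x2; rewrite /block /Num.max; case: ltP => //; lra.
  by rewrite exprz2E exprS; field; rewrite pow2_neq0.
apply: (@pl_affine _ _ _ _ (k%:Z - (p * k)%:Z)
  (1 + (2 ^+ (p * k).+1)^-1 - (2 ^+ (p + p * k))^-1 - 2 ^ (k%:Z - (p * k)%:Z))) => //.
- exact: dyadicB.
- by do 2![apply: dyadicB => //]; exact: dyadicD.
move=> x /andP[x1 x2]; rewrite (@rescalingE k) ?x2 ?(le_trans (ltW lc) x1)//.
have -> : block (2 ^+ k * (1 - x)) = 2 ^+ k * (1 - x) - 1 / 2 + e.
  by have := wc' _ x1; rewrite /block /Num.max; case: ltP => //; lra.
by rewrite exprz2E exprS exprD; field; rewrite !pow2_neq0.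
Qed.

Lemma rescalingP : rescales 1 p rescaling.
Proof.
split.
- by move=> x; apply: flip_extend_in => //; exact: block_in.
- by move=> x; rewrite /rescaling /flip_extend => /negbTE ->.
- by move=> n x; exact: flip_extend_scale.
case=> // n _; rewrite mul1n; elim: n => [|n IH].
  by have := rescaling_pl_block 0; rewrite expr0 invr1 subrr.
by apply: pl_cat IH _; exact: rescaling_pl_block.
Qed.

Lemma rescaling0 : rescaling 0 = 0.
Proof.
rewrite (@rescalingE 0); last by rewrite expr0 invr1 subrr lexx subr_ge0 pow2V_le1.
have [e0 e4] := e_bounds.
rewrite subr0 mulr1 muln0 expr0 divr1.
by rewrite /block /Num.max; case: ltP; move: e0 e4; lra.
Qed.

End Rescaling.

(** * The maximal subgroup *)

Section Conjugation.
Variables (R : realType) (p : nat).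
Hypothesis p_prime : prime p.
Implicit Types (f g k : thompsonF R) (a t x : R).

Let p_gt1 : (1 < p)%N := prime_gt1 p_prime.

Local Notation h := (@rescaling R p).
Local Notation hV := (@rescaling_inv R p).
Local Notation col := (@color R p).

Definition color_fixed_near1 f :=
  exists2 a, a < 1 & forall t, dyadicI t -> a <= t -> col (f t) = col t.

Lemma rescaling_conjP f :
  is_thompson (h \o f \o hV) /\ exists m : int, slope_at1 (h \o f \o hV) (p%:Z * m).
Proof.
have [m fm] := thompson_slope_at1 (thompsonP f).
have [] := rescales_conj (isT : (0 < 1)%N) (rescalingP _ p_gt1) (rescalingK p_gt1)
  (rescaling_invK p_gt1) (rescaling0 _ p_gt1) (thompsonP f) (m := m).
  by rewrite mul1r.
by move=> H1 H2; split=> //; exists m.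
Qed.

Definition rescaling_conj f : thompsonF R :=
  ThompsonF (asboolT (rescaling_conjP f).1).

Lemma rescaling_conjE f t : rescaling_conj f t = h (f (hV t)).
Proof. by []. Qed.

Lemma rescaling_conjM f g :
  rescaling_conj (f * g)%g = (rescaling_conj f * rescaling_conj g)%g.
Proof.
by apply: thompsonF_eqP => t; rewrite F_mulE !rescaling_conjE F_mulE rescalingK.
Qed.

Lemma rescaling_conj_inj : injective rescaling_conj.
Proof.
move=> f g E; apply: thompsonF_eqP => t.
have /(congr1 hV) : rescaling_conj f (h t) = rescaling_conj g (h t) by rewrite E.
by rewrite !rescaling_conjE !rescalingK.
Qed.

Lemma rescaling_conj1 : rescaling_conj 1%g = 1%g.
Proof. by apply: (mulgI (rescaling_conj 1%g)); rewrite -rescaling_conjM !mulg1. Qed.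

Lemma rescaling_conjV f : rescaling_conj f^-1%g = (rescaling_conj f)^-1%g.
Proof.
by apply: (mulgI (rescaling_conj f)); rewrite -rescaling_conjM !mulgV rescaling_conj1.
Qed.

Lemma Fp_intr0 (m : int) : (m%:~R == 0 :> 'F_p) = (p%:Z %| m)%Z.
Proof. by rewrite -(dvdz_pcharf (pchar_Fp p_prime)). Qed.

Lemma rescaling_conj_near1 f : color_fixed_near1 (rescaling_conj f).
Proof.
have [_ [m Hm]] := rescaling_conjP f.
have [a a1 aP] := slope_at1_color p_prime Hm; exists a => // t Dt at_.
rewrite rescaling_conjE aP// (_ : _%:~R = 0) ?subr0//.
by apply/eqP; rewrite Fp_intr0 dvdz_mulr.
Qed.

(** Near 1 the colour shift is minus the logarithm of the slope, so that the
    slope of an element fixing the colours is a power of [2 ^ p], which is what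
    conjugation by [h^-1] turns into a power of 2. *)
Lemma rescaling_conj_onto k : color_fixed_near1 k -> exists f, rescaling_conj f = k.
Proof.
move=> [a a1 aP]; have Fk := thompsonP k.
have [m km] := thompson_slope_at1 Fk.
have [b b1 bP] := slope_at1_color p_prime km.
have : (p%:Z %| m)%Z.
  rewrite -Fp_intr0.
  have max1 : Num.max 0 (Num.max a b) < 1 by rewrite !gt_max ltr01 a1.
  have max0 : 0 <= Num.max 0 (Num.max a b) by rewrite le_max lexx.
  have [t [Dt]] := dyadicI_between p_prime max0 max1 (lexx 1) 0.
  rewrite !gt_max => /and3P[_ at_ bt] _ _.
  have := bP t Dt (ltW bt); rewrite aP ?ltW// => E.
  have -> : m%:~R = col t - (col t - m%:~R) by ring.
  by rewrite -E subrr.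
case/dvdzP => m' mE.
have [] := rescales_conj (ltnW p_gt1)
  (rescales_inv (rescalingP _ p_gt1) (rescalingK p_gt1) (rescaling_invK p_gt1)
     (rescaling0 _ p_gt1))
  (rescaling_invK p_gt1) (rescalingK p_gt1) _ Fk (m := m').
- by rewrite -{1}(rescaling0 _ p_gt1) rescalingK.
- by rewrite mulrC -mE.
move=> Ff _; exists (ThompsonF (asboolT Ff)).
by apply: thompsonF_eqP => t; rewrite rescaling_conjE /= !rescaling_invK.
Qed.

Definition maximal_copy : set (thompsonF R) :=
  [set f | jones_subgroup R p (rescaling_conj f)].

Lemma jones_onto k : jones_subgroup R p k -> exists2 f, maximal_copy f & rescaling_conj f = k.
Proof.
move=> Jk; have [|f fE] := @rescaling_conj_onto k; last by exists f; rewrite // /maximal_copy /= fE.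
by exists 0; rewrite ?ltr01// => t Dt _; exact: (jones_subgroupP p_prime k).1 Jk t Dt.
Qed.

Lemma maximal_copy_group : is_subgroup maximal_copy.
Proof.
have [J1 JV] := jones_subgroup_subgroup R p.
split; first by rewrite inE /maximal_copy /= rescaling_conj1; apply: set_mem.
move=> f g; rewrite !inE /maximal_copy /= rescaling_conjM rescaling_conjV => Jf Jg.
by apply: set_mem; apply: JV; rewrite inE.
Qed.

(** Some element preserving the colours near 1, hence a conjugate, moves a point
    of colour 0 to a point of colour 1. *)
Lemma maximal_copy_proper : maximal_copy <> setT.
Proof.
move=> E.
have [z [Dz z0 z1 cz]] := dyadicI_between p_prime (lexx (0 : R)) ltr01 (lexx 1) 0.
have [y [Dy y0 y1 cy]] := dyadicI_between p_prime (lexx (0 : R)) ltr01 (lexx 1) 1.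
have max1 : Num.max z y < 1 by rewrite gt_max z1.
have max0 : 0 <= Num.max z y by rewrite le_max (ltW z0).
have [x [Dx]] := dyadicI_between p_prime max0 max1 (lexx 1) 0.
rewrite gt_max => /andP[zx yx] x1 cx.
have [k [kz kx k1 k2]] := exists_shift p_prime Dz Dx Dy Dx zx yx (erefl _).
have [|f fE] := @rescaling_conj_onto k.
  exists x => // t Dt xt; apply: k2 => //.
  by rewrite negb_and -[~~ (t < x)]leNgt xt orbT.
have : maximal_copy f by rewrite E.
rewrite /maximal_copy /= fE => /(jones_subgroupP p_prime)/(_ z Dz).
by rewrite kz cz cy => /eqP; rewrite oner_eq0.
Qed.

Lemma maximal_copyP : maximal_subgroup maximal_copy.
Proof.
split; [exact: maximal_copy_group|exact: maximal_copy_proper|move=> K Kg MK].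
have [KM|] := pselect (K `<=` maximal_copy); first by left; apply/seteqP.
move=> /nonsubset [f0 [Kf0 Mf0]]; right.
pose L := rescaling_conj @` K.
have Lg : is_subgroup L.
  split; first by rewrite inE; exists 1%g; [apply: set_mem; exact: Kg.1|exact: rescaling_conj1].
  move=> _ _ /set_mem[f Kf <-] /set_mem[g Kg' <-]; rewrite inE.
  exists (f / g)%g; last by rewrite rescaling_conjM rescaling_conjV.
  by apply: set_mem; apply: Kg.2; rewrite inE.
have LJ : jones_subgroup R p `<=` L.
  by move=> k /jones_onto[f Mf <-]; exists f => //; exact: MK.
apply/seteqP; split=> // f _.
have [|g Kg' /rescaling_conj_inj <-//] :=
  jones_overgroup p_prime Lg LJ (k0 := rescaling_conj f0) _ Mf0 (rescaling_conj_near1 f).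
by exists f0.
Qed.

End Conjugation.

Theorem corollary7p17 (R : realType) (p : nat) (p_prime : prime p) :
  exists M : set (thompsonF R),
    maximal_subgroup M /\ isomorphic_subgroups M (jones_subgroup R p).
Proof.
exists (@maximal_copy R p p_prime); split; first exact: maximal_copyP.
exists (rescaling_conj p_prime); split.
  split; first by [].
    by move=> f g _ _; exact: rescaling_conj_inj.
  by move=> k /(jones_onto p_prime)[f Mf <-]; exists f.
by move=> f g _ _; exact: rescaling_conjM.
Qed.
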